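(* Assume the standing assumptions (a)–(d) below, and let $T\in(0,\infty)$, $\epsilon\in[0,\infty)$ satisfy $$LT^2\le \tfrac35\min\Big(\tfrac14,\ \tfrac{3}{1280\,L\tilde R^2}\Big),\qquad \epsilon\tilde L\le \frac{5}{64}\,\frac{K}{\sqrt{7/6+3/(2KT^2)}}\exp\Big(-\frac{5\tilde R}{2T}-5\Big).$$ Then for all $x,x'\in\mathbb{R}^{Nd}$, $$\mathbb{E}\Big[\frac1N\sum_{i=1}^N\rho(\mathbf X^i(x,x'),\mathbf X'^i(x,x'))\Big]\le(1-c)\frac1N\sum_{i=1}^N\rho(x^i,x'^i),\qquad c=\frac{KT^2}{156}\exp\Big(-\frac{5\tilde R}{4T}\Big).$$
   Context: Standing assumptions: $V:\mathbb{R}^d\to\mathbb{R}$, $W:\mathbb{R}^d\times\mathbb{R}^d\to\mathbb{R}$ are $C^1$, $\nabla_1W$ the gradient in the first argument, constants $L>0,K>0,\mathcal R\ge0,\tilde L\ge0$ with: (a) $V(0)=0$, $V\ge0$; (b) $|\nabla V(x)-\nabla V(y)|\le L|x-y|$; (c) $\langle x-y,\nabla V(x)-\nabla V(y)\rangle\ge K|x-y|^2+L^{-1}|\nabla V(x)-\nabla V(y)|^2$ whenever $|x-y|\ge\mathcal R$; (d) $W$ symmetric, $|\nabla_1W(x,y)-\nabla_1W(\tilde x,\tilde y)|\le\tilde L(|x-\tilde x|+|y-\tilde y|)$. $\tilde R=\sqrt{(2L+K)/(6K)}\mathcal R$ (with $1/0=\infty$), $R_1=\frac54(\tilde R+2T)$,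 $\gamma=\min(T^{-1},\tilde R^{-1}/4)$, $f(r)=\int_0^re^{-\min(R_1,s)/T}\mathrm{d}s$, $\rho(a,b)=f(|a-b|)$ for $a,b\in\mathbb{R}^d$. Points of $\mathbb{R}^{Nd}$: $x=(x^1,\dots,x^N)$. $U(x)=\sum_i\big(V(x^i)+\frac\epsilon{2N}\sum_jW(x^i,x^j)\big)$; exact flow $(q_t,p_t)(x,v)$: $\dot q^i_t=p^i_t$, $\dot p^i_t=-\nabla_iU(q_t)$, $(q_0,p_0)=(x,v)$. Particle-wise coupling of xHMC: $\mathbf X^i(x,x')=q^i_T(x,\xi)$, $\mathbf X'^i(x,x')=q^i_T(x',\eta)$, where $\xi\sim\mathcal N(0,I_{Nd})$, $\mathcal V_1,\dots,\mathcal V_N$ i.i.d. uniform on $[0,1]$ independent of $\xi$, $z^i=x^i-x'^i$, $e^i=z^i/|z^i|$ (arbitrary unit vector if $z^i=0$), $\varphi_{0,1}$ the standard normal density; if $|z^i|\ge\tilde R$ then $\eta^i=\xi^i$, otherwise $\eta^i=\xi^i+\gamma z^i$ if $\mathcal V_i\le\varphi_{0,1}(e^i\cdot\xi^i+\gamma|z^i|)/\varphi_{0,1}(e^i\cdot\xi^i)$ and $\eta^i=\xi^i-2(e^i\cdot\xi^i)e^i$ else. *)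

(* Defs.v *)
From HB Require Import structures.
From mathcomp Require Import all_boot all_order all_algebra.
From mathcomp Require Import all_classical all_reals all_analysis.
Set Implicit Arguments. Unset Strict Implicit. Unset Printing Implicit Defensive.
Import Order.TTheory GRing.Theory Num.Theory.
Import numFieldNormedType.Exports.
Local Open Scope classical_set_scope.
Local Open Scope ring_scope.

(* Frobenius / Euclidean inner product on m x n real matrices
   (row vectors 'rV_d represent points of R^d, 'M_(N,d) points of R^{Nd}). *)
Definition frob {R : realType} {m n : nat} (A B : 'M[R]_(m, n)) : R :=
  \sum_(i < m) \sum_(k < n) A i k * B i k.

Definition enorm {R : realType} {m n : nat} (A : 'M[R]_(m, n)) : R :=
  Num.sqrt (frob A A).

Definition is_gradient {R : realType} {m n : nat} (f : 'M[R]_(m, n) -> R)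
  (x g : 'M[R]_(m, n)) : Prop :=
  differentiable f x /\ forall h : 'M[R]_(m, n), 'D_h f x = frob h g.

Definition mutually_independent {d0} {Omega : measurableType d0} {R : realType}
  (P : probability Omega R) (I : finType) (X : I -> Omega -> R) : Prop :=
  forall A : I -> set R, (forall i, measurable (A i)) ->
    P (\bigcap_(i in [set: I]) (X i @^-1` A i)) =
    (\big[*%E/1%E]_(i : I) P (X i @^-1` A i))%E.

Definition phi01 {R : realType} (u : R) : R :=
  expR (- (u ^+ 2) / 2) / Num.sqrt (pi *+ 2).

Section Consts.
Variables (R : realType) (L K calR T : R).

Definition Rtilde : R := Num.sqrt ((2 * L + K) / (6 * K)) * calR.

Definition R1 : R := 5 / 4 * (Rtilde + 2 * T).

(* gamma = min(T^{-1}, tilde R^{-1}/4), with 1/0 = infinity *)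
Definition gammaC : R :=
  if Rtilde == 0 then T^-1 else Num.min T^-1 (Rtilde^-1 / 4).

Definition fdist (r : R) : R :=
  Rintegral (@lebesgue_measure R) `[0, r] (fun s => expR (- Num.min R1 s / T)).

Definition rho {d : nat} (a b : 'rV[R]_d) : R := fdist (enorm (a - b)).

(* min(1/4, 3/(1280 L tilde R^2)) with 1/0 = infinity *)
Definition stepMin : R :=
  if Rtilde == 0 then 1 / 4 else Num.min (1 / 4) (3 / (1280 * L * Rtilde ^+ 2)).

End Consts.

(* the coupled initial velocity eta^i of particle i *)
Definition eta_i {R : realType} {d : nat} (Rt gam : R) (xi z e : 'rV[R]_d) (Vi : R)
  : 'rV[R]_d :=
  if Rt <= enorm z then xi
  else if Vi <= phi01 (frob e xi + gam * enorm z) / phi01 (frob e xi)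
       then xi + gam *: z
       else xi - (2 * frob e xi) *: e.

Definition Upot {R : realType} {N d : nat} (V : 'rV[R]_d -> R)
  (W : 'rV[R]_d -> 'rV[R]_d -> R) (eps : R) (x : 'M[R]_(N, d)) : R :=
  \sum_(i < N) (V (row i x) + eps / (2 * N%:R) * \sum_(j < N) W (row i x) (row j x)).

(* Main.v *)
Require Import Defs.
From HB Require Import structures.
From mathcomp Require Import all_boot all_order all_algebra.
From mathcomp Require Import all_classical all_reals all_analysis.
From mathcomp Require Import measurable_realfun.
From mathcomp Require Import ring lra.
Import Order.TTheory GRing.Theory Num.Theory.
Import numFieldNormedType.Exports.
Local Open Scope classical_set_scope.
Local Open Scope ring_scope.

Set Implicit Arguments. Unset Strict Implicit. Unset Printing Implicit Defensive.

(** For particle i let z be the difference of the two positions, r its initial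
norm and w the difference of the velocities.  The differential system for z has
a force of norm at most L |z| plus an interaction of norm at most
eps Lt (|z| + mean of the |z^j|); since L T^2 is small, the maxima of the |z|
over [0, T] are controlled by the free motions z + t w.

If r >= Rtilde the initial velocities agree.  Either the trajectory stays at
distance at least calR, and the functional
|z + (T - t) w|^2 + (T - t)^2 |w|^2 decreases thanks to the cocoercivity (c),
which gives |z_T| <= (1 - 0.36 K T^2) r up to interaction, or r is dominated by
the interaction.  If r < Rtilde and the shift is accepted, then
|z_T| <= (1 - 0.9 gamma T) r up to interaction.  Otherwise the velocities are
reflected and f increases by at most T exp(- r / T) plus a small tail beyond R1;
given u = e . xi this has probability at most gamma r (u + 1/8)^+, so all the
expectations reduce to that of (u + 1)^2, which is bounded through the moment
generating function of u.  The smallness of eps Lt lets the contraction absorb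
the interaction after averaging over the particles.  Measurability of the flow
is never needed, because the integrand is bounded pointwise by a measurable
function of (xi, V). *)

(** * Euclidean norm and matrix-valued derivatives *)

Section Frobenius.
Context {R : realType} {m n : nat}.
Implicit Types A B C : 'M[R]_(m, n).

Lemma frobC A B : frob A B = frob B A.
Proof. by apply: eq_bigr => i _; apply: eq_bigr => k _; rewrite mulrC. Qed.

Lemma frobDl A B C : frob (A + B) C = frob A C + frob B C.
Proof.
rewrite /frob -big_split; apply: eq_bigr => i _; rewrite -big_split.
by apply: eq_bigr => k _; rewrite mxE mulrDl.
Qed.

Lemma frobZl c A B : frob (c *: A) B = c * frob A B.
Proof.
rewrite /frob mulr_sumr; apply: eq_bigr => i _; rewrite mulr_sumr.
by apply: eq_bigr => k _; rewrite mxE mulrA.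
Qed.

Lemma frobDr A B C : frob A (B + C) = frob A B + frob A C.
Proof. by rewrite frobC frobDl !(frobC A). Qed.

Lemma frobZr c A B : frob A (c *: B) = c * frob A B.
Proof. by rewrite frobC frobZl frobC. Qed.

Lemma frobNl A B : frob (- A) B = - frob A B.
Proof. by rewrite -scaleN1r frobZl mulN1r. Qed.

Lemma frobNr A B : frob A (- B) = - frob A B.
Proof. by rewrite frobC frobNl frobC. Qed.

Lemma frob0l B : frob 0 B = 0.
Proof. by rewrite -(scale0r 0) frobZl mul0r. Qed.

Lemma frob_ge0 A : 0 <= frob A A.
Proof. by apply: sumr_ge0 => i _; apply: sumr_ge0 => k _; rewrite -expr2 sqr_ge0. Qed.

Lemma frob_eq0 A : frob A A = 0 -> A = 0.
Proof.
move=> /eqP; rewrite psumr_eq0; last first.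
  by move=> i _; apply: sumr_ge0 => k _; rewrite -expr2 sqr_ge0.
move=> /allP A0; apply/matrixP => i j; rewrite mxE.
have := A0 i (mem_index_enum i); rewrite /= psumr_eq0; last first.
  by move=> k _; rewrite -expr2 sqr_ge0.
move=> /allP/(_ j (mem_index_enum j))/=.
by rewrite -expr2 sqrf_eq0 => /eqP.
Qed.

Lemma frob_inj A B : (forall H, frob H A = frob H B) -> A = B.
Proof.
move=> AB; apply/eqP; rewrite -subr_eq0; apply/eqP/frob_eq0.
by rewrite frobDr frobNr AB subrr.
Qed.

Lemma enorm_ge0 A : 0 <= enorm A. Proof. exact: sqrtr_ge0. Qed.

Lemma enorm_sqr A : enorm A ^+ 2 = frob A A.
Proof. by rewrite sqr_sqrtr// frob_ge0. Qed.

Lemma enorm0 : enorm (0 : 'M[R]_(m, n)) = 0.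
Proof. by rewrite /enorm frob0l sqrtr0. Qed.

Lemma enorm_eq0 A : enorm A = 0 -> A = 0.
Proof. by move=> A0; apply: frob_eq0; rewrite -enorm_sqr A0 expr0n. Qed.

Lemma enormZ c A : enorm (c *: A) = `|c| * enorm A.
Proof.
by rewrite /enorm frobZl frobZr mulrA -expr2 sqrtrM ?sqr_ge0// sqrtr_sqr.
Qed.

Lemma enormN A : enorm (- A) = enorm A.
Proof. by rewrite -scaleN1r enormZ normrN1 mul1r. Qed.

(** Cauchy-Schwarz: outside the degenerate cases, expand the square of [enorm B *: A - enorm A *: B]
    and divide by [2 |A| |B|]. *)
Lemma frob_le A B : frob A B <= enorm A * enorm B.
Proof.
have [A0|] := eqVneq (enorm A) 0.
  by rewrite A0 (enorm_eq0 A0) frob0l mul0r.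
have [B0|] := eqVneq (enorm B) 0.
  by rewrite B0 (enorm_eq0 B0) frobC frob0l mulr0.
move=> Bn0 An0.
have a0 : 0 < enorm A by rewrite lt_neqAle eq_sym An0 enorm_ge0.
have b0 : 0 < enorm B by rewrite lt_neqAle eq_sym Bn0 enorm_ge0.
have := frob_ge0 (enorm B *: A - enorm A *: B).
rewrite frobDl !frobDr !frobNl !frobNr !frobZl !frobZr (frobC B A).
rewrite -!enorm_sqr => H.
rewrite -(ler_pM2l (mulr_gt0 a0 b0)); lra.
Qed.

Lemma enormD A B : enorm (A + B) <= enorm A + enorm B.
Proof.
rewrite -(@ler_pXn2r _ 2) ?nnegrE ?addr_ge0 ?enorm_ge0//.
rewrite enorm_sqr frobDl !frobDr -!enorm_sqr (frobC B A).
by have := frob_le A B; lra.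
Qed.

Lemma enormB A B : enorm (A - B) <= enorm A + enorm B.
Proof. by rewrite (le_trans (enormD _ _))// enormN. Qed.

Lemma enorm_sum (I : Type) (r : seq I) (P : pred I) (F : I -> 'M[R]_(m, n)) :
  enorm (\sum_(i <- r | P i) F i) <= \sum_(i <- r | P i) enorm (F i).
Proof.
elim/big_ind2 : _ => //; first by rewrite enorm0.
by move=> A a B b Aa Bb; rewrite (le_trans (enormD _ _))// lerD.
Qed.

(** Testing with [H = A] suffices. Norm bounds along curves are derived through the functionals
    [frob H], which stay differentiable where [enorm] is not. *)
Lemma enorm_le_dual A c : 0 <= c ->
  (forall H, frob H A <= enorm H * c) -> enorm A <= c.
Proof.
move=> c0 /(_ A); rewrite -enorm_sqr expr2.
have [->//|A0] := eqVneq (enorm A) 0.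
by rewrite ler_pM2l// lt_neqAle eq_sym A0 enorm_ge0.
Qed.

End Frobenius.

Section RealDerivative.
Context {R : realType}.
Implicit Types (f g : R -> R) (t : R).

Lemma is_derive_mulr f g df dg t : is_derive t 1 f df -> is_derive t 1 g dg ->
  is_derive t 1 (fun s => f s * g s) (df * g t + f t * dg).
Proof.
move=> fd gd; apply: (is_derive_eq (is_deriveM fd gd)).
by rewrite addrC; congr (_ + _); exact: mulrC.
Qed.

Lemma is_derive_mull c f df t : is_derive t 1 f df ->
  is_derive t 1 (fun s => c * f s) (c * df).
Proof. by move=> fd; apply: (is_derive_eq (is_deriveZ c fd)). Qed.

Lemma is_derive_sqr f df t : is_derive t 1 f df ->
  is_derive t 1 (fun s => f s ^+ 2) (2 * f t * df).
Proof. by move=> fd; apply: (is_derive_eq (is_deriveX 2 fd)); rewrite expr1. Qed.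

Lemma is_derive_subl c t : is_derive t 1 (fun s => c - s) (-1 : R).
Proof.
by apply: (is_derive_eq (is_deriveB (is_derive_cst c t 1) (is_derive_id t 1)));
  rewrite sub0r.
Qed.

End RealDerivative.

Section MatrixDerivative.
Context {R : realType} {m n : nat}.

Lemma is_derive_coord (M : R -> 'M[R]_(m, n)) (dM : 'M[R]_(m, n)) (t : R) :
  is_derive t 1 M dM -> forall i j, is_derive t 1 (fun s => M s i j) (dM i j).
Proof.
move=> Md i j.
have dv : derivable M t 1 by exact: ex_derive.
apply: DeriveDef; first by move/derivable_mxP : dv; exact.
have := derive_mx dv; rewrite derive_val => ->.
by rewrite mxE.
Qed.

Lemma is_derive_mx (M : R -> 'M[R]_(m, n)) (dM : 'M[R]_(m, n)) (t : R) :
  (forall i j, is_derive t 1 (fun s => M s i j) (dM i j)) -> is_derive t 1 M dM.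
Proof.
move=> Md.
have dv : derivable M t 1 by apply/derivable_mxP => i j; exact: ex_derive.
apply: DeriveDef => //; rewrite derive_mx//; apply/matrixP => i j.
by rewrite mxE; exact: derive_val.
Qed.

Lemma is_derive_frob (A B : R -> 'M[R]_(m, n)) (dA dB : 'M[R]_(m, n)) (t : R) :
  is_derive t 1 A dA -> is_derive t 1 B dB ->
  is_derive t 1 (fun s => frob (A s) (B s)) (frob dA (B t) + frob (A t) dB).
Proof.
move=> /is_derive_coord Ad /is_derive_coord Bd.
have -> : (fun s => frob (A s) (B s)) =
    \sum_(i < m) \sum_(k < n) (fun s => A s i k * B s i k).
  apply/funext => s; rewrite fct_sumE; apply: eq_bigr => i _.
  by rewrite fct_sumE.
rewrite /frob -big_split/=; apply: is_derive_sum => i.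
rewrite -big_split/=; apply: is_derive_sum => k.
exact: is_derive_mulr.
Qed.

Lemma is_derive_cstf (A : 'M[R]_(m, n)) (t : R) : is_derive t 1 (fun=> A) 0.
Proof. exact: is_derive_cst. Qed.

End MatrixDerivative.

Lemma is_derive_row {R : realType} {m n : nat} (M : R -> 'M[R]_(m, n)) dM (t : R) i :
  is_derive t 1 M dM -> is_derive t 1 (fun s => row i (M s)) (row i dM).
Proof.
move=> /is_derive_coord Md; apply: is_derive_mx => a j; rewrite mxE.
have -> : (fun s => row i (M s) a j) = (fun s => M s i j).
  by apply/funext => s; rewrite mxE.
exact: Md.
Qed.

Lemma nonincreasing_from0 {R : realType} (g dg : R -> R) (T t : R) :
  (forall s : R, is_derive s 1 g (dg s)) ->
  (forall s : R, 0 <= s <= T -> dg s <= 0) -> 0 <= t <= T -> g t <= g 0.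
Proof.
move=> gd g0 /andP[t0 tT].
have cg : {within `[0, t], continuous g}.
  by apply: derivable_within_continuous => s _; exact: ex_derive.
have [c] := MVT_segment t0 (fun s _ => gd s) cg.
rewrite in_itv/= => /andP[c0 ct] gE.
rewrite -subr_le0 gE subr0 mulr_le0_ge0// g0// c0/=.
exact: le_trans tT.
Qed.

(** * Second-order trajectories *)

(** For each fixed [H] the scalar function [frob H (y s) - enorm H * B s] is nonincreasing by
    Cauchy-Schwarz; [enorm_le_dual] then removes [H]. *)
Lemma enorm_growth {R : realType} {m n : nat} (y dy : R -> 'M[R]_(m, n))
    (B dB : R -> R) (T t : R) :
  (forall s : R, is_derive s 1 y (dy s)) ->
  (forall s : R, is_derive s 1 B (dB s)) ->
  (forall s : R, 0 <= s <= T -> enorm (dy s) <= dB s) ->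
  0 <= t <= T -> enorm (y t - y 0) <= B t - B 0.
Proof.
move=> yd Bd dyB tT.
have key H : frob H (y t) - enorm H * B t <= frob H (y 0) - enorm H * B 0.
  apply: (@nonincreasing_from0 _ (fun s => frob H (y s) - enorm H * B s)
    (fun s => frob H (dy s) - enorm H * dB s) _ _ _ _ tT) => [s|s sT].
    have d1 := is_derive_frob (is_derive_cstf H s) (yd s).
    have d2 := is_deriveZ (enorm H) (Bd s).
    apply: (is_derive_eq (is_deriveB d1 d2)).
    by rewrite frob0l add0r.
  rewrite subr_le0 (le_trans (frob_le _ _))//.
  by rewrite ler_wpM2l ?enorm_ge0// dyB.
apply: enorm_le_dual => [|H].
  rewrite subr_ge0 -lerN2; apply: (@nonincreasing_from0 _ (fun s => - B s)
    (fun s => - dB s) _ _ (fun s => is_deriveN (Bd s)) _ tT) => s sT.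
  by rewrite oppr_le0 (le_trans (enorm_ge0 _) (dyB s sT)).
by have := key H; rewrite frobDr frobNr; lra.
Qed.

Section SecondOrder.
Context {R : realType} {m n : nat}.
Variables (z w a : R -> 'M[R]_(m, n)) (T C : R).
Hypothesis zd : forall s : R, is_derive s 1 z (w s).
Hypothesis wd : forall s : R, is_derive s 1 w (a s).

Lemma norm_attains_max : 0 <= T -> exists2 c, 0 <= c <= T &
  forall s : R, 0 <= s <= T -> enorm (z s) <= enorm (z c).
Proof.
move=> T0.
have cz : {within `[0, T], continuous (fun s => frob (z s) (z s))}.
  apply: derivable_within_continuous => s _.
  by have dz := is_derive_frob (zd s) (zd s); exact: ex_derive.
have [c c0T zc] := EVT_max T0 cz.
exists c; first by move: c0T; rewrite in_itv.
by move=> s sT; rewrite ler_wsqrtr// zc// in_itv.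
Qed.

Hypothesis aC : forall s : R, 0 <= s <= T -> enorm (a s) <= C.

Lemma velocity_bound t : 0 <= t <= T -> enorm (w t - w 0) <= C * t.
Proof.
move=> tT.
have Bd (s : R) : is_derive s 1 (fun x : R => C * x) C.
  by apply: (is_derive_eq (is_derive_mull C (is_derive_id s 1))); rewrite mulr1.
by have := enorm_growth wd Bd aC tT; rewrite mulr0 subr0.
Qed.

(** Second-order Taylor bound: [enorm_growth] is applied to [z s - s *: w 0], whose derivative
    [velocity_bound] controls. *)
Lemma position_bound t : 0 <= t <= T ->
  enorm (z t - z 0 - t *: w 0) <= C * t ^+ 2 / 2.
Proof.
move=> tT.
pose y s := z s - s *: w 0.
have yd (s : R) : is_derive s 1 y (w s - w 0).
  have d1 : is_derive s 1 (fun x : R => x *: w 0) (w 0).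
    apply: is_derive_mx => i j.
    have -> : (fun x : R => (x *: w 0) i j) = (fun x : R => w 0 i j * x).
      by apply/funext => x; rewrite mxE mulrC.
    by apply: (is_derive_eq (is_derive_mull _ (is_derive_id s 1))); rewrite mulr1.
  exact: (is_deriveB (zd s) d1).
have Bd (s : R) : is_derive s 1 (fun x : R => C / 2 * x ^+ 2) (C * s).
  by apply: (is_derive_eq (is_derive_mull _ (is_derive_sqr (is_derive_id s 1)))); lra.
have := enorm_growth yd Bd velocity_bound tT.
rewrite /y scale0r subr0 expr0n/= mulr0 subr0 addrAC => /le_trans; apply.
by rewrite mulrAC.
Qed.

End SecondOrder.

(* The functional [|z + tau w|^2 + tau^2 |w|^2] with [tau = T - t] equals
   [|z 0|^2] at time 0, since [w 0 = 0], and [|z T|^2] at time [T].  The cross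
   term [2 tau <w, D>] is absorbed by the cocoercivity term [|D|^2 / L] and
   the damping [- |w|^2] coming from the weight [tau^2]. *)
Lemma cocoercive_contraction {R : realType} {m n : nat}
    (z w D de : R -> 'M[R]_(m, n)) (T L K mn S Dl : R) :
  (forall s : R, is_derive s 1 z (w s)) ->
  (forall s : R, is_derive s 1 w (- (D s + de s))) ->
  w 0 = 0 -> 0 <= T -> 0 < L -> 0 <= K -> 0 <= mn -> L * T ^+ 2 <= 1 ->
  (forall s : R, 0 <= s <= T -> mn <= enorm (z s)) ->
  (forall s : R, 0 <= s <= T -> K * enorm (z s) ^+ 2 + L^-1 * enorm (D s) ^+ 2 <= frob (z s) (D s)) ->
  (forall s : R, 0 <= s <= T -> enorm (z s + (2 * (T - s)) *: w s) <= S) ->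
  (forall s : R, 0 <= s <= T -> enorm (de s) <= Dl) ->
  enorm (z T) ^+ 2 <= enorm (z 0) ^+ 2 - T ^+ 2 * (K * mn ^+ 2 - S * Dl).
Proof.
move=> zd wd w0 T0 L0 K0 mn0 LT hmn hco hS hD.
pose y s := z s + (T - s) *: w s.
pose v s := (T - s) *: w s.
have scd (s : R) : is_derive s 1 v (- w s + (T - s) *: - (D s + de s)).
  apply: is_derive_mx => i j.
  have -> : (fun x : R => v x i j) = (fun x : R => (T - x) * w x i j).
    by apply/funext => x; rewrite !mxE.
  apply: (is_derive_eq (is_derive_mulr (is_derive_subl T s)
    (is_derive_coord (wd s) i j))).
  by rewrite !mxE mulN1r.
have yd (s : R) : is_derive s 1 y ((T - s) *: - (D s + de s)).
  by apply: (is_derive_eq (is_deriveD (zd s) (scd s))); rewrite addrA subrr add0r.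
(* The functional decreases at rate at least [2 (T - s) Q]; subtracting [Q (T - s)^2] turns this
   into monotonicity of [g], with total gain [T^2 Q]. *)
pose Q := K * mn ^+ 2 - S * Dl.
pose g s := frob (y s) (y s) + frob (v s) (v s) - Q * (T - s) ^+ 2.
have gd (s : R) : is_derive s 1 g (2 * (T - s) *
    (- frob (z s + (2 * (T - s)) *: w s) (D s + de s) - enorm (w s) ^+ 2 + Q)).
  have d1 := is_derive_frob (yd s) (yd s).
  have d2 := is_derive_frob (scd s) (scd s).
  have d3 := is_derive_mull Q (is_derive_sqr (is_derive_subl T s)).
  apply: (is_derive_eq (is_deriveB (is_deriveD d1 d2) d3)).
  rewrite /y /v enorm_sqr.
  rewrite !(frobDl, frobDr, frobNl, frobNr, frobZl, frobZr).
  rewrite !(frobC (D s)) !(frobC (de s)).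
  ring.
have gT : g T <= g 0.
  apply: (@nonincreasing_from0 _ g _ T T gd) => [s sT|]; last by rewrite T0 lexx.
  have Ts : 0 <= T - s by case/andP: sT; lra.
  rewrite mulr_ge0_le0//; first by rewrite mulr_ge0.
  have h1 := hmn s sT; have h2 := hco s sT; have h3 := hS s sT; have h4 := hD s sT.
  have b1 : - frob (z s + (2 * (T - s)) *: w s) (de s) <= S * Dl.
    rewrite -frobNl (le_trans (frob_le _ _))// enormN.
    by rewrite ler_pM ?enorm_ge0.
  have b2 : - frob (w s) (D s) <= enorm (w s) * enorm (D s).
    by rewrite -frobNl (le_trans (frob_le _ _))// enormN.
  have b3 : K * mn ^+ 2 <= K * enorm (z s) ^+ 2.
    by rewrite ler_wpM2l// ler_pXn2r ?nnegrE ?enorm_ge0.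
  have b4 : L * (T - s) ^+ 2 <= 1.
    rewrite (le_trans _ LT)// (ler_wpM2l (ltW L0))// ler_pXn2r ?nnegrE//.
    by case/andP: sT; lra.
  have b5 : 2 * (T - s) * (enorm (w s) * enorm (D s)) <=
      L^-1 * enorm (D s) ^+ 2 + L * (T - s) ^+ 2 * enorm (w s) ^+ 2.
    have -> : L * (T - s) ^+ 2 * enorm (w s) ^+ 2 =
        L^-1 * (L * (T - s) * enorm (w s)) ^+ 2 by field; rewrite gt_eqF.
    have -> : 2 * (T - s) * (enorm (w s) * enorm (D s)) =
        L^-1 * (2 * enorm (D s) * (L * (T - s) * enorm (w s))).
      by field; rewrite gt_eqF.
    rewrite -mulrDr ler_pM2l ?invr_gt0//.
    by have := sqr_ge0 (enorm (D s) - L * (T - s) * enorm (w s)); lra.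
  have b6 : L * (T - s) ^+ 2 * enorm (w s) ^+ 2 <= enorm (w s) ^+ 2.
    by rewrite ler_piMl ?sqr_ge0.
  have b7 : 2 * (T - s) * - frob (w s) (D s) <= 2 * (T - s) * (enorm (w s) * enorm (D s)).
    by rewrite ler_wpM2l// mulr_ge0.
  by rewrite frobDr [frob _ (D s)]frobDl frobZl /Q; lra.
move: gT; rewrite /g /y /v subrr scale0r w0 !scaler0 !addr0 frob0l -!enorm_sqr.
rewrite subr0 /Q; lra.
Qed.

Section OneParticle.
Context {R : realType} {m n : nat}.
Variables (z w D de : R -> 'M[R]_(m, n)) (T L K e Mb M : R).
Hypothesis zd : forall s : R, is_derive s 1 z (w s).
Hypothesis wd : forall s : R, is_derive s 1 w (- (D s + de s)).
Hypothesis T0 : 0 <= T.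
Hypothesis L0 : 0 < L.
Hypothesis e0 : 0 <= e.
Hypothesis Mb0 : 0 <= Mb.
Hypothesis LT : L * T ^+ 2 <= 3 / 20.
Hypothesis eL : e <= L / 1000.
Hypothesis zM : forall s : R, 0 <= s <= T -> enorm (z s) <= M.
Hypothesis DL : forall s : R, 0 <= s <= T -> enorm (D s) <= L * enorm (z s).
Hypothesis dee : forall s : R, 0 <= s <= T -> enorm (de s) <= e * (enorm (z s) + Mb).

(** Bound for the acceleration on [[0, T]]. Later [M] is the maximum of [enorm (z s)] and [Mb] the
    mean of these maxima over the particles. *)
Let C := (L + e) * M + e * Mb.

Lemma M_ge0 : 0 <= M.
Proof. by rewrite (le_trans (enorm_ge0 (z 0)))// zM// lexx. Qed.

Lemma acc_bound s : 0 <= s <= T -> enorm (- (D s + de s)) <= C.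
Proof.
move=> sT; rewrite enormN (le_trans (enormD _ _))//.
rewrite (le_trans (lerD (DL sT) (dee sT)))//.
have := zM sT; rewrite /C => zs; have := enorm_ge0 (z s).
have h1 : L * enorm (z s) <= L * M by rewrite (ler_wpM2l (ltW L0)).
have h2 : e * enorm (z s) <= e * M by rewrite ler_wpM2l.
lra.
Qed.

Lemma C_ge0 : 0 <= C.
Proof. by rewrite (le_trans (enorm_ge0 _) (@acc_bound 0 _))// lexx. Qed.

Lemma drift_bound t : 0 <= t <= T -> enorm (z t - z 0 - t *: w 0) <= C * T ^+ 2 / 2.
Proof.
move=> tT; rewrite (le_trans (position_bound zd wd acc_bound tT))//.
rewrite ler_wpM2r// ler_wpM2l ?C_ge0// ler_pXn2r ?nnegrE//; by case/andP: tT.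
Qed.

Lemma near_free_bound t b : 0 <= t <= T -> enorm (z 0 + t *: w 0) <= b ->
  enorm (z t) <= b + C * T ^+ 2 / 2.
Proof.
move=> tT zb; have -> : z t = (z t - z 0 - t *: w 0) + (z 0 + t *: w 0).
  by rewrite -[_ - _ - _]addrA -opprD subrK.
by rewrite (le_trans (enormD _ _))// addrC lerD// drift_bound.
Qed.

Hypothesis zMatt : exists2 c, 0 <= c <= T & M = enorm (z c).

Lemma eT_le : e * T ^+ 2 <= 3 / 20000.
Proof.
have := ler_wpM2r (sqr_ge0 T) eL; move: LT; lra.
Qed.

Lemma C_le : C * T ^+ 2 / 2 <= 751 / 10000 * M + e * T ^+ 2 * Mb / 2.
Proof.
have h1 := ler_wpM2r M_ge0 LT; have h2 := ler_wpM2r M_ge0 eT_le.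
rewrite /C; have := M_ge0; lra.
Qed.

(** At the time where [M] is attained, the deviation from free motion is at most [0.0751 M] plus the
    interaction, and the term in [M] is absorbed on the left. *)
Lemma max_bound b : (forall t : R, 0 <= t <= T -> enorm (z 0 + t *: w 0) <= b) ->
  M <= 109 / 100 * b + 55 / 100 * (e * T ^+ 2 * Mb).
Proof.
move=> hb; have [c cT Mc] := zMatt.
have h := near_free_bound cT (hb c cT); rewrite -Mc in h.
have b0 : 0 <= b by rewrite (le_trans (enorm_ge0 _) (hb c cT)).
have h0 : 0 <= e * T ^+ 2 * Mb by rewrite !mulr_ge0// sqr_ge0.
have := C_le; lra.
Qed.

(** Unless the interaction [q] dominates, the trajectory stays within [0.14 r] of its start, hence
    at distance at least [Rr]. Cocoercivity then holds on all of [[0, T]] and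
    [cocoercive_contraction] applies. *)
Lemma parallel_contraction (Rr : R) :
  w 0 = 0 -> 0 <= K -> e <= K / 1000 -> K <= L / 4 ->
  Rr <= 82 / 100 * enorm (z 0) ->
  (forall s : R, 0 <= s <= T -> Rr <= enorm (z s) ->
    K * enorm (z s) ^+ 2 + L^-1 * enorm (D s) ^+ 2 <= frob (z s) (D s)) ->
  enorm (z T) <= enorm (z 0) - 36 / 100 * (K * T ^+ 2 * enorm (z 0))
     + 16 / 10 * (e * T ^+ 2 * Mb).
Proof.
move=> w0 K0 eK KL Rr0 hco.
set r := enorm (z 0); set q := e * T ^+ 2 * Mb.
have r0 : 0 <= r by exact: enorm_ge0.
have q0 : 0 <= q by rewrite /q !mulr_ge0// sqr_ge0.
have TT : 0 <= T <= T by rewrite T0 lexx.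
have Mr : M <= 109 / 100 * r + 55 / 100 * q.
  by apply: max_bound => t _; rewrite w0 scaler0 addr0.
have KT0 : 0 <= K * T ^+ 2 by rewrite mulr_ge0// sqr_ge0.
have KT1 : K * T ^+ 2 <= 3 / 80.
  by have := ler_wpM2r (sqr_ge0 T) KL; move: LT; lra.
have zT := zM TT.
(* If [q > r / 10], the crude bound [1.09 r + 0.55 q] is already below the claim, since [1.05 q]
   exceeds [0.09 r + 0.36 K T^2 r]. *)
have [qr|qr] := ltP (r / 10) q.
  have := ler_wpM2r r0 KT1; lra.
have [rz|rn0] := eqVneq r 0.
  by move: qr Mr; rewrite rz; nra.
have rp : 0 < r by rewrite lt_neqAle eq_sym rn0.
have Cr : C * T ^+ 2 / 2 <= 136 / 1000 * r.
  by have := C_le; rewrite -/q; lra.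
have zlow s : 0 <= s <= T -> 86 / 100 * r <= enorm (z s).
  move=> sT; have h := drift_bound sT; rewrite w0 scaler0 subr0 in h.
  have : r <= enorm (z s) + enorm (z s - z 0).
    have {1}-> : r = enorm (z s - (z s - z 0)) by rewrite /r subKr.
    exact: enormB.
  by lra.
have hS s : 0 <= s <= T -> enorm (z s + (2 * (T - s)) *: w s) <= 13 / 10 * r.
  move=> sT; have /andP[s0 s1] := sT.
  rewrite (le_trans (enormD _ _))// enormZ ger0_norm; last by lra.
  have hw := velocity_bound wd acc_bound sT; rewrite w0 subr0 in hw.
  have h1 : 2 * (T - s) * enorm (w s) <= 2 * (T - s) * (C * s).
    by rewrite ler_wpM2l//; lra.
  have h2 : 2 * (T - s) * (C * s) <= C * T ^+ 2 / 2.
    rewrite -subr_ge0 [leRHS](_ : _ = C / 2 * (T - 2 * s) ^+ 2); last by field.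
    by rewrite mulr_ge0 ?sqr_ge0// divr_ge0// C_ge0.
  have := zM sT; lra.
have hD s : 0 <= s <= T -> enorm (de s) <= e * (M + Mb).
  by move=> sT; rewrite (le_trans (dee sT))// ler_wpM2l// lerD2r zM.
have hco' s : 0 <= s <= T -> K * enorm (z s) ^+ 2 + L^-1 * enorm (D s) ^+ 2 <= frob (z s) (D s).
  by move=> sT; apply: hco => //; have := zlow s sT; move: Rr0; rewrite -/r; lra.
have LT1 : L * T ^+ 2 <= 1 by move: LT; lra.
have mn0 : 0 <= 86 / 100 * r by lra.
have := cocoercive_contraction zd wd w0 T0 L0 K0 mn0 LT1 zlow hco' hS hD.
rewrite -/r => H.
have eT : e * T ^+ 2 <= K * T ^+ 2 / 1000.
  by have := ler_wpM2r (sqr_ge0 T) eK; lra.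
have eM : e * T ^+ 2 * M <= K * T ^+ 2 / 1000 * (1145 / 1000 * r).
  by rewrite ler_pM ?M_ge0// ?mulr_ge0 ?sqr_ge0//; lra.
have erM := ler_wpM2l r0 eM.
(* [0.86^2 = 0.7396] leaves room for the interaction term in [M] above [0.72 = 2 * 0.36]. *)
have H2 : enorm (z T) ^+ 2 <= r * (r - 72 / 100 * (K * T ^+ 2 * r) + 13 / 10 * q).
  have : 0 <= r * (r * (K * T ^+ 2)) by rewrite !mulr_ge0 ?sqr_ge0.
  rewrite /q; lra.
(* The estimate of the square is made linear by [2 r s <= r^2 + s^2], which halves the
   coefficients. *)
have H3 : 2 * r * enorm (z T) <= r * (r + (r - 72 / 100 * (K * T ^+ 2 * r) + 13 / 10 * q)).
  by have := sqr_ge0 (r - enorm (z T)); lra.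
rewrite -(ler_pM2l rp).
have := mulr_ge0 r0 q0; lra.
Qed.

(** The free motion is radial, [(1 - ga * t) *: z 0]. As [L T^2 <= 3/20 ga T], the force destroys
    less than a tenth of the gain [ga T r]. *)
Lemma coalescing_bound (ga : R) :
  w 0 = - (ga *: z 0) -> 0 <= ga -> ga * T <= 1 -> L * T ^+ 2 <= 3 / 20 * (ga * T) ->
  enorm (z T) <= enorm (z 0) - 9 / 10 * (ga * T * enorm (z 0)) + 6 / 10 * (e * T ^+ 2 * Mb).
Proof.
move=> w0 ga0 gaT LTg.
set r := enorm (z 0); set q := e * T ^+ 2 * Mb.
have r0 : 0 <= r by exact: enorm_ge0.
have q0 : 0 <= q by rewrite /q !mulr_ge0// sqr_ge0.
have TT : 0 <= T <= T by rewrite T0 lexx.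
have free t : 0 <= t <= T -> enorm (z 0 + t *: w 0) = (1 - ga * t) * r.
  move=> /andP[t0 tT].
  have -> : z 0 + t *: w 0 = (1 - ga * t) *: z 0.
    by rewrite w0 scalerN scalerA scalerBl scale1r mulrC.
  rewrite enormZ ger0_norm// subr_ge0 (le_trans _ gaT)//.
  by rewrite ler_wpM2l.
have Mr : M <= 109 / 100 * r + 55 / 100 * q.
  apply: max_bound => t tT; rewrite free// ler_piMl//.
  by rewrite gerBl mulr_ge0//; case/andP: tT.
have zT := near_free_bound TT (lexx _); rewrite free// in zT.
have g0 : 0 <= ga * T by rewrite mulr_ge0.
have eT : e * T ^+ 2 <= 3 / 20000 * (ga * T).
  by have := ler_wpM2r (sqr_ge0 T) eL; lra.
have h1 : (L * T ^+ 2 + e * T ^+ 2) * M <= 1502 / 10000 * (ga * T) * (109 / 100 * r + 55 / 100 * q).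
  apply: ler_pM Mr; [|exact: M_ge0|by lra].
  by rewrite addr_ge0// mulr_ge0 ?sqr_ge0// ltW.
have h2 : ga * T * q <= q by rewrite ler_piMl.
have h3 : 0 <= ga * T * r by rewrite mulr_ge0.
move: zT; rewrite /C -/r.
have -> : ((L + e) * M + e * Mb) * T ^+ 2 / 2 = ((L * T ^+ 2 + e * T ^+ 2) * M + q) / 2.
  by rewrite /q; field.
lra.
Qed.

End OneParticle.

(** * Gradient of the mean-field potential *)

Section PotentialGradient.
Context {R : realType}.

Lemma frob_rows {m n : nat} (A B : 'M[R]_(m, n)) :
  frob A B = \sum_(i < m) frob (row i A) (row i B).
Proof.
apply: eq_bigr => i _; rewrite /frob big_ord1.
by apply: eq_bigr => k _; rewrite !mxE.
Qed.

Lemma frob_sumr {m n : nat} (I : Type) (r : seq I) (A : 'M[R]_(m, n)) F :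
  frob A (\sum_(i <- r) F i) = \sum_(i <- r) frob A (F i).
Proof.
elim/big_ind2 : _ => //; first by rewrite frobC frob0l.
by move=> X x Y y <- <-; rewrite frobDr.
Qed.

(** For linear [l], the difference quotients of [F \o l] along [h] and of [F] along [l h] are the
    same function. *)
Lemma is_derive_comp_linear {X Y : normedModType R} (l : X -> Y) (F : Y -> R) x h dF :
  (forall (c : R) u v, l (c *: u + v) = c *: l u + l v) ->
  is_derive (l x) (l h) F dF -> is_derive x h (F \o l) dF.
Proof.
move=> hl Fd.
have E : (fun c => c^-1 *: (((F \o l) \o shift x) (c *: h) - (F \o l) x)) =
  (fun c => c^-1 *: ((F \o shift (l x)) (c *: l h) - F (l x))).
  by apply/funext => c /=; rewrite hl.
apply: DeriveDef.
  by rewrite /derivable E; exact: (@ex_derive _ _ _ _ _ _ _ Fd).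
by rewrite /derive E; exact: (@derive_val _ _ _ _ _ _ _ Fd).
Qed.

Lemma is_derive_gradient {m n : nat} (f : 'M[R]_(m, n) -> R) x g h :
  is_gradient f x g -> is_derive x h f (frob h g).
Proof. by move=> [fd fg]; apply: DeriveDef; [exact: (diff_derivable fd)|exact: fg]. Qed.

Variables (N d : nat) (V : 'rV[R]_d -> R) (W : 'rV[R]_d -> 'rV[R]_d -> R).
Variables (gradV : 'rV[R]_d -> 'rV[R]_d) (gradW1 : 'rV[R]_d -> 'rV[R]_d -> 'rV[R]_d).
Variable (eps : R).
Hypothesis hV : forall x, is_gradient V x (gradV x).
Hypothesis hW : forall p : 'rV[R]_d * 'rV[R]_d, differentiable (fun q => W q.1 q.2) p.
Hypothesis hW1 : forall x y, is_gradient (fun z => W z y) x (gradW1 x y).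
Hypothesis Wsym : forall x y, W x y = W y x.

(** The direction is split into its two slots; symmetry of [W] expresses the derivative in the
    second slot by [gradW1] with swapped arguments. *)
Lemma is_derive_symmetric_pair (p v : 'rV[R]_d * 'rV[R]_d) :
  is_derive p v (fun q => W q.1 q.2)
    (frob v.1 (gradW1 p.1 p.2) + frob v.2 (gradW1 p.2 p.1)).
Proof.
set F := fun q => _; have Fp := hW p.
apply: DeriveDef; first exact: (diff_derivable Fp).
have -> : v = (v.1, 0) + (0, v.2)
  by case: v => a b; apply: injective_projections => /=; rewrite ?addr0 ?add0r.
rewrite deriveE// linearD -!deriveE//=. congr (_ + _).
- rewrite addr0 -(proj2 (hW1 p.1 p.2)).
  have E : (fun c => c^-1 *: ((F \o shift p) (c *: (v.1, 0)) - F p)) =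
    (fun c => c^-1 *: (((fun z => W z p.2) \o shift p.1) (c *: v.1) - W p.1 p.2)).
    by apply/funext => c; rewrite /F /= scaler0 add0r.
  by rewrite /derive E.
- rewrite add0r -(proj2 (hW1 p.2 p.1)).
  have E : (fun c => c^-1 *: ((F \o shift p) (c *: (0, v.2)) - F p)) =
    (fun c => c^-1 *: (((fun z => W z p.1) \o shift p.2) (c *: v.2) - W p.2 p.1)).
    by apply/funext => c; rewrite /F /= scaler0 add0r !(Wsym p.1).
  by rewrite /derive E.
Qed.

(** Each pair contributes through both of its particles; exchanging the two sums shows the
    contributions equal, which cancels the factor [1/2] in [Upot]. *)
Lemma is_derive_Upot (x h : 'M[R]_(N, d)) :
  is_derive x h (Upot V W eps)
   (\sum_(i < N) frob (row i h) (gradV (row i x) +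
      (eps / N%:R) *: \sum_(j < N) gradW1 (row i x) (row j x))).
Proof.
have d1 (i : 'I_N) : is_derive x h (fun y => V (row i y)) (frob (row i h) (gradV (row i x))).
  apply: (is_derive_comp_linear (l := row i)) => [c u v|]; first by rewrite linearP.
  exact: is_derive_gradient.
have d2 (i j : 'I_N) : is_derive x h (fun y => W (row i y) (row j y))
    (frob (row i h) (gradW1 (row i x) (row j x)) + frob (row j h) (gradW1 (row j x) (row i x))).
  apply: (is_derive_comp_linear (l := fun y => (row i y, row j y)) (F := fun q => W q.1 q.2)).
    by move=> c u v; rewrite !linearP.
  exact: (is_derive_symmetric_pair (row i x, row j x) (row i h, row j h)).
have -> : Upot V W eps = \sum_(i < N) ((fun y => V (row i y)) +
    (eps / (2 * N%:R)) *: \sum_(j < N) (fun y : 'M[R]_(N, d) => W (row i y) (row j y))).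
  apply/funext => y; rewrite fct_sumE; apply: eq_bigr => i _.
  rewrite /Upot; congr (_ + _); rewrite /GRing.scale/=; congr (_ * _).
  by rewrite fct_sumE.
apply: (is_derive_eq (is_derive_sum (fun i => is_deriveD (d1 i)
   (is_deriveZ _ (is_derive_sum (d2 i)))))).
rewrite big_split/= [RHS](_ : _ = \sum_(i < N) frob (row i h) (gradV (row i x)) +
  eps / N%:R * \sum_(i < N) \sum_(j < N) frob (row i h) (gradW1 (row i x) (row j x))).
  congr (_ + _); rewrite -scaler_sumr.
  under eq_bigr do rewrite big_split.
  rewrite big_split/= [X in _ + X]exchange_big/= -mulr2n.
  rewrite -scalerMnr scalerMnl; apply: (congr1 (fun c => c * _)).
  rewrite -mulr_natr.
  rewrite invfM; have -> : eps * (2^-1 / N%:R) * 2 = (2^-1 * 2) * (eps / N%:R) by ring.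
  by rewrite mulVf// mul1r.
rewrite mulr_sumr -big_split; apply: eq_bigr => i _.
by rewrite frobDr frobZr frob_sumr.
Qed.

(** The flow comes with some gradient of the potential; the directional derivatives identify it with
    the explicit matrix [G]. *)
Lemma gradient_Upot_row (x g : 'M[R]_(N, d)) i :
  is_gradient (Upot V W eps) x g ->
  row i g = gradV (row i x) + (eps / N%:R) *: \sum_(j < N) gradW1 (row i x) (row j x).
Proof.
move=> Ug; pose G := \matrix_i (gradV (row i x) +
  (eps / N%:R) *: \sum_(j < N) gradW1 (row i x) (row j x)).
suff -> : g = G by rewrite rowK.
apply: frob_inj => H; rewrite -(proj2 Ug) (@derive_val _ _ _ _ _ _ _ (is_derive_Upot x H)).
by rewrite frob_rows; apply: eq_bigr => k _; rewrite rowK.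
Qed.

End PotentialGradient.

(** * The concave distance *)

Section Distance.
Context {R : realType}.
Variables (L K calR T : R).
Hypothesis T0 : 0 < T.

Local Notation R1 := (R1 L K calR T).
Local Notation f := (fdist L K calR T).
Local Notation mu := (@lebesgue_measure R).
Let slope (s : R) := expR (- Num.min R1 s / T).

Let slope_continuous : continuous slope.
Proof.
move=> s; apply: continuous_comp; last exact: continuous_expR.
apply: cvgM; last exact: cvg_cst.
apply: cvgN.
exact: (@continuous_min _ _ (cst R1) id s (@cst_continuous _ _ R1 s) (@cvg_id _ _)).
Qed.

Let slope_integrable a b : mu.-integrable `[a, b] (EFin \o slope).
Proof.
apply: continuous_compact_integrable; first exact: segment_compact.
exact: continuous_subspaceT.
Qed.

Let slope_le (s t : R) : s <= t -> slope t <= slope s.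
Proof.
move=> st; rewrite ler_expR ler_pM2r ?invr_gt0// lerN2.
by rewrite le_min !ge_min lexx st orbT.
Qed.

Let slope_min s : expR (- R1 / T) <= slope s.
Proof. by rewrite ler_expR ler_pM2r ?invr_gt0// lerN2 ge_min lexx. Qed.

Let fdistB s t : 0 <= s -> s <= t -> f t - f s = Rintegral mu `[s, t] slope.
Proof.
move=> s0 st; rewrite /fdist (Rintegral_itvB (slope_integrable 0 t)); [|by rewrite bnd_simp..].
rewrite Rintegral_itv_obnd_cbnd//.
apply: integrableS (slope_integrable s t) => //.
by apply: subset_itvr; rewrite bnd_simp.
Qed.

Let Rintegral_const (s t c : R) : s <= t -> Rintegral mu `[s, t] (cst c) = c * (t - s).
Proof.
move=> st; rewrite Rintegral_cst//= lebesgue_measure_itv/= lte_fin.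
case: ltP => [_//|ts]; have -> : s = t by apply/eqP; rewrite eq_le st.
by rewrite subrr mulr0.
Qed.

Let cst_integrable (s t c : R) : mu.-integrable `[s, t] (EFin \o cst c).
Proof.
apply: continuous_compact_integrable; first exact: segment_compact.
by apply: continuous_subspaceT => x; exact: cvg_cst.
Qed.

Lemma fdist_incr_ge (s t c : R) : 0 <= s -> s <= t ->
  (forall x, s <= x <= t -> c <= expR (- Num.min R1 x / T)) ->
  c * (t - s) <= f t - f s.
Proof.
move=> s0 st hc; rewrite fdistB// -Rintegral_const//.
apply: (le_Rintegral _ (@cst_integrable s t c) (slope_integrable s t)) => //.
Qed.

Lemma fdist_incr_le (s t c : R) : 0 <= s -> s <= t ->
  (forall x, s <= x <= t -> expR (- Num.min R1 x / T) <= c) ->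
  f t - f s <= c * (t - s).
Proof.
move=> s0 st hc; rewrite fdistB// -Rintegral_const//.
apply: (le_Rintegral _ (slope_integrable s t) (@cst_integrable s t c)) => //.
Qed.

Lemma fdist0 : f 0 = 0.
Proof. by rewrite /fdist set_itv1 Rintegral_set1. Qed.

Lemma fdist_slope (s r : R) : 0 <= s -> s <= r ->
  expR (- Num.min R1 r / T) * (r - s) <= f r - f s.
Proof.
move=> s0 sr; apply: fdist_incr_ge => // x /andP[_ xr]; exact: slope_le.
Qed.

Lemma fdist_min_slope (s t : R) : 0 <= s -> s <= t ->
  expR (- R1 / T) * (t - s) <= f t - f s.
Proof. by move=> s0 st; apply: fdist_incr_ge => // x _; exact: slope_min. Qed.

Lemma fdist_le (s t : R) : 0 <= s -> s <= t -> f s <= f t.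
Proof.
move=> s0 st; rewrite -subr_ge0 (le_trans _ (fdist_min_slope s0 st))//.
by rewrite mulr_ge0 ?expR_ge0// subr_ge0.
Qed.

Hypothesis R10 : 0 <= R1.

Lemma fdist_lip (s t : R) : 0 <= s -> s <= t -> f t - f s <= t - s.
Proof.
move=> s0 st; rewrite -[leRHS]mul1r; apply: fdist_incr_le => // x /andP[sx _].
rewrite -expR0 ler_expR mulNr oppr_le0 divr_ge0 ?(ltW T0)// le_min R10.
exact: le_trans sx.
Qed.

Lemma fdist_ge_linear (r : R) : 0 <= r -> expR (- R1 / T) * r <= f r.
Proof. by move=> r0; have := fdist_min_slope (lexx 0) r0; rewrite fdist0 !subr0. Qed.

Lemma fdist_le_id (r : R) : 0 <= r -> f r <= r.
Proof. by move=> r0; have := fdist_lip (lexx 0) r0; rewrite fdist0 !subr0. Qed.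

Lemma fdist_ge0 (r : R) : 0 <= r -> 0 <= f r.
Proof. by move=> r0; rewrite -fdist0 fdist_le. Qed.

(** Below [R1] the integrand is [exp (- x / T)], with antiderivative [G]; the contribution of the
    upper end has a favourable sign. *)
Let fdist_below (r s : R) : 0 <= r -> r <= s -> s <= R1 -> f s - f r <= T * expR (- r / T).
Proof.
move=> r0; rewrite le_eqVlt => /predU1P[<- _|rs sR].
  by rewrite subrr mulr_ge0 ?expR_ge0// ltW.
pose G x := - T * expR (- x / T).
have Gd (x : R) : is_derive x 1 G (expR (- x / T)).
  have d1 : is_derive x 1 (fun y => - y / T) (- T^-1).
    have -> : (fun y => - y / T) = (fun y : R => - T^-1 * y).
      by apply/funext => y; rewrite mulNr mulrC mulNr.
    by apply: (is_derive_eq (is_derive_mull _ (is_derive_id x 1))); rewrite mulr1.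
  have d2 := @is_derive1_comp _ expR (fun y : R => - y / T) x _ _ (is_derive_expR _) d1.
  apply: (is_derive_eq (is_derive_mull (- T) d2)).
  by rewrite mulrCA mulrNN mulfV ?gt_eqF// mulr1.
have -> : f s - f r = G s - G r.
  rewrite fdistB//; last exact: ltW.
  rewrite /Rintegral (continuous_FTC2 rs (F := G)) //.
  - exact: continuous_subspaceT.
  - split.
    + by move=> x _; exact: ex_derive.
    + by apply: cvg_at_right_filter; apply: differentiable_continuous;
        apply/derivable1_diffP; exact: ex_derive.
    + by apply: cvg_at_left_filter; apply: differentiable_continuous;
        apply/derivable1_diffP; exact: ex_derive.
  - move=> x; rewrite in_itv/= => /andP[_ xs].
    rewrite derive1E derive_val /slope min_r//.
    by rewrite (le_trans (ltW xs)).
by rewrite /G; have := mulr_ge0 (ltW T0) (expR_ge0 (- s / T)); lra.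
Qed.

(* Below [R1] the remaining increase of [f] is at most the integral of [exp (- s / T)]
   up to infinity; beyond [R1] the slope is constant. *)
Lemma fdist_jump (r s : R) : 0 <= r -> r <= R1 -> 0 <= s ->
  f s - f r <= T * expR (- r / T) + expR (- R1 / T) * Num.max 0 (s - R1).
Proof.
move=> r0 rR s0.
have p1 : 0 <= T * expR (- r / T) by rewrite mulr_ge0 ?expR_ge0// ltW.
have p2 : 0 <= expR (- R1 / T) * Num.max 0 (s - R1).
  by rewrite mulr_ge0 ?expR_ge0// le_max lexx.
have [sr|rs] := leP s r; first by have := fdist_le s0 sr; lra.
have [sR|Rs] := leP s R1; first by have := fdist_below r0 (ltW rs) sR; lra.
have h1 := fdist_below r0 rR (lexx _).
have h2 : f s - f R1 <= expR (- R1 / T) * (s - R1).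
  apply: fdist_incr_le => //; first exact: ltW.
  by move=> x /andP[Rx _]; rewrite min_l.
have -> : Num.max 0 (s - R1) = s - R1 by rewrite max_r// subr_ge0 ltW.
lra.
Qed.

End Distance.

(** * Integrals, Gaussian moments and independence *)

Section Integration.
Local Open Scope ereal_scope.

(** The integral of a nonnegative function is a supremum over the simple functions below it, so
    monotonicity holds for arbitrary functions. This is how the coupled flow enters the
    expectation. *)
Lemma ge0_integral_mono {d} {T : measurableType d} {R : realType}
    (mu : {measure set T -> \bar R}) (f g : T -> \bar R) :
  (forall x, 0 <= f x) -> (forall x, f x <= g x) ->
  \int[mu]_x f x <= \int[mu]_x g x.
Proof.
move=> f0 fg; rewrite !ge0_integralTE//; last first.
  by move=> x; exact: le_trans (fg x).
apply: le_ereal_sup => _ [h hf <-]; exists h => // x.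
exact: le_trans (fg x).
Qed.

Lemma probability_integral_cst {d} {T : measurableType d} {R : realType}
    (P : probability T R) (r : R) : \int[P]_x r%:E = r%:E.
Proof.
by rewrite integral_cst//; have /= -> := @probability_setT _ _ _ P; rewrite mule1.
Qed.

Lemma ge0_integral_scale {d} {T : measurableType d} {R : realType}
    (mu : {measure set T -> \bar R}) (k : R) (f : T -> R) :
  measurable_fun setT f -> (forall x, (0 <= f x)%R) -> (0 <= k)%R ->
  \int[mu]_x (k%:E * (f x)%:E) = k%:E * \int[mu]_x (f x)%:E.
Proof.
move=> mf f0 k0; apply: ge0_integralZl => [//||x _|]; last by rewrite lee_fin.
  exact/measurable_EFinP.
by rewrite lee_fin.
Qed.

Import HBNNSimple.

(** Indicators first, then simple functions by linearity, then monotone convergence. *)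
Lemma ge0_integral_density {d} {T : measurableType d} {R : realType}
    (mu nu : {measure set T -> \bar R}) (g : T -> R) :
  measurable_fun setT g -> (forall x, (0 <= g x)%R) ->
  (forall A, measurable A -> nu A = \int[mu]_(x in A) (g x)%:E) ->
  forall f : T -> \bar R, measurable_fun setT f -> (forall x, 0 <= f x) ->
  \int[nu]_x f x = \int[mu]_x (f x * (g x)%:E).
Proof.
move=> mg g0 nuE.
have Eg : measurable_fun setT (EFin \o g) by exact/measurable_EFinP.
have indicE' A : measurable A ->
    \int[nu]_x (\1_A x)%:E = \int[mu]_x ((\1_A x)%:E * (g x)%:E).
  move=> mA; rewrite integral_indic//= setIT nuE// integral_mkcond.
  apply: eq_integral => x _; rewrite patchE indicE.
  by case: ifPn => xA; rewrite ?mul1e ?mul0e.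
have sfE (h : {nnsfun T >-> R}) :
    \int[nu]_x (h x)%:E = \int[mu]_x ((h x)%:E * (g x)%:E).
  under [LHS]eq_integral do rewrite fimfunE -fsumEFin//.
  rewrite [LHS]ge0_integral_fsum//; last 2 first.
    - by move=> r; exact/measurable_EFinP/measurableT_comp.
    - by move=> n x _; rewrite EFinM nnfun_muleindic_ge0.
  under [RHS]eq_integral.
    move=> x xD; rewrite fimfunE -fsumEFin// ge0_mule_fsuml; last first.
      by move=> r; rewrite EFinM nnfun_muleindic_ge0.
    over.
  rewrite [RHS]ge0_integral_fsum//; last 2 first.
    - move=> r; apply: emeasurable_funM => //.
      by apply/measurable_EFinP; apply: measurableT_comp.
    - move=> n x _; apply: mule_ge0; last by rewrite lee_fin.
      by rewrite EFinM nnfun_muleindic_ge0.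
  apply: eq_fsbigr => r _.
  rewrite integralZl_indic_nnsfun//= indicE'//.
  have [r0|r0] := leP 0%R r.
    rewrite -ge0_integralZl//.
    - by apply: eq_integral => x _; rewrite EFinM muleA.
    - by apply: emeasurable_funM => //; apply/measurable_EFinP.
    - by move=> x _; rewrite mule_ge0 ?lee_fin.
  (* A nonnegative simple function does not take a negative value [r], so this summand is zero on
     both sides. *)
  rewrite (_ : h @^-1` [set r] = set0); last first.
    apply/seteqP; split => // x /= hx; move: r0; rewrite -hx ltNge.
    by rewrite fun_ge0.
  under eq_integral do rewrite indic0 mul0e.
  rewrite integral0 mule0; under eq_integral do rewrite indic0 mulr0 mul0e.
  by rewrite integral0.
move=> f mf f0.
pose f_ := nnsfun_approx measurableT mf.
transitivity (lim (\int[nu]_x (f_ n x)%:E @[n --> \oo])).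
  rewrite -monotone_convergence//=.
  - apply: eq_integral => ? /[!inE] xD; apply/esym/cvg_lim => //=.
    exact: cvg_nnsfun_approx.
  - by move=> n; exact/measurable_EFinP/measurable_funTS.
  - by move=> n ? _; rewrite lee_fin.
  - by move=> ? _ ? ? mn; rewrite lee_fin; exact/lefP/nd_nnsfun_approx.
under eq_fun do rewrite sfE.
rewrite -monotone_convergence//=.
- apply: eq_integral => x _; apply/cvg_lim => //.
  apply: cvgeZr => //; exact: cvg_nnsfun_approx.
- by move=> n; apply: emeasurable_funM => //; exact/measurable_EFinP/measurable_funTS.
- by move=> n ? _; rewrite mule_ge0// lee_fin.
- move=> x _ m n mn; apply: lee_wpmul2r; first by rewrite lee_fin.
  by rewrite lee_fin; exact/lefP/nd_nnsfun_approx.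
Qed.

End Integration.

Section NormalMgf.
Local Open Scope ereal_scope.
Context {R : realType}.

(** Completing the square: [expR (h * x)] times the standard density is [expR (h ^+ 2 / 2)] times
    the density centred at [h]. *)
Lemma normal_mgf (h : R) :
  \int[normal_prob 0 1]_x (expR (h * x))%:E = (expR (h ^+ 2 / 2))%:E.
Proof.
rewrite (ge0_integral_density (mu := lebesgue_measure) (measurable_normal_pdf 0 1)).
- transitivity (\int[lebesgue_measure]_x ((expR (h ^+ 2 / 2))%:E * (normal_pdf h 1 x)%:E)).
    apply: eq_integral => x _; rewrite -!EFinM !normal_pdfE ?oner_eq0//; congr EFin.
    rewrite [LHS]mulrCA [RHS]mulrCA; congr (_ * _)%R.
    rewrite /normal_fun -!expRD; congr expR; rewrite expr1n; by field.
  transitivity ((expR (h ^+ 2 / 2))%:E *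
      \int[lebesgue_measure]_(x in setT) (normal_pdf h 1 x)%:E); last first.
    by rewrite integral_normal_pdf mule1.
  apply: ge0_integral_scale => [|x|]; [exact: measurable_normal_pdf| |].
  - exact: normal_pdf_ge0.
  - exact: expR_ge0.
- by move=> x; exact: normal_pdf_ge0.
- by [].
- by apply/measurable_EFinP; apply: measurableT_comp => //; exact: measurable_funM.
- by move=> x; rewrite lee_fin expR_ge0.
Qed.

Lemma uniform_tail (c : R) : (0 <= c)%R ->
  uniform_prob (@ltr01 R) `]c, +oo[ <= (Num.max 0 (1 - c))%:E.
Proof.
move=> c0; rewrite /uniform_prob integral_uniform_pdf.
apply: (@le_trans _ _ (\int[@lebesgue_measure R]_(x in `]c, (Num.max c 1)%R]%classic) 1)).
  rewrite [leLHS]integral_mkcond [leRHS]integral_mkcond.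
  apply: ge0_integral_mono => x.
    by rewrite patchE; case: ifPn => // _; rewrite lee_fin uniform_pdf_ge0.
  rewrite !patchE; case: ifPn.
    rewrite inE/= => -[]; rewrite !in_itv/= andbT => cx /andP[x0 x1].
    rewrite ifT; last by rewrite inE/= in_itv/= cx le_max x1 orbT.
    by rewrite /uniform_pdf x0 x1/= subr0 invr1.
  by move=> _; case: ifPn.
rewrite integral_cst// mul1e [leLHS]lebesgue_measure_itv/= lte_fin.
case: ifPn => cm; last by rewrite lee_fin le_max lexx.
rewrite -EFinB lee_fin !le_max; case: (leP c 1%R) cm => [c1|c1] cm.
  by rewrite lexx orbT.
by rewrite subrr lexx.
Qed.

End NormalMgf.

Section Independence.
Local Open Scope ereal_scope.
Context {d0} {Omega : measurableType d0} {R : realType} (P : probability Omega R).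

Section Family.
Variables (I : finType) (X : I -> Omega -> R) (j0 : I).
Hypothesis indep : mutually_independent P X.
Hypothesis mX : forall i, measurable_fun setT (X i).

(* The pi-system of cylinders not involving the coordinate [j0]. *)
Let cyl : set (set Omega) := [set E | exists A : I -> set R,
  [/\ forall i, measurable (A i), A j0 = setT &
      E = \bigcap_(i in [set: I]) (X i @^-1` A i)]].

Let cyl_preimage j B : j != j0 -> measurable B -> cyl (X j @^-1` B).
Proof.
move=> jj0 mB; exists (fun i => if i == j then B else setT); split.
- by move=> i; case: ifP.
- by rewrite eq_sym (negbTE jj0).
- apply/seteqP; split => [w Bw i _ /=|w /(_ j Logic.I)/=]; last by rewrite eqxx.
  by case: eqP => // ->.
Qed.

Let measurable_cyl : cyl `<=` measurable.
Proof.
move=> _ [A [mA _ ->]]; apply: fin_bigcap_measurable => //.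
by move=> i _; rewrite -[_ @^-1` _]setTI; exact: mX.
Qed.

Let cylT : cyl setT.
Proof.
by exists (fun=> setT); split => //; apply/esym; rewrite -subTset => w _ i _.
Qed.

Let cylI : setI_closed cyl.
Proof.
move=> _ _ [A [mA Aj ->]] [B [mB Bj ->]]; exists (fun i => A i `&` B i); split.
- by move=> i; exact: measurableI.
- by rewrite Aj Bj setIT.
- by rewrite -bigcapI.
Qed.

(** The slot [j0] of a cylinder is the whole line, so it is free to receive [B], and the product
    formula applies twice. *)
Let cyl_indep E B : cyl E -> measurable B ->
  P (E `&` X j0 @^-1` B) = P (X j0 @^-1` B) * P E.
Proof.
move=> [A [mA Aj ->]] mB.
pose A' i := if i == j0 then B else A i.
have -> : \bigcap_(i in [set: I]) (X i @^-1` A i) `&` X j0 @^-1` B =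
    \bigcap_(i in [set: I]) (X i @^-1` A' i).
  apply/seteqP; split => w.
    by move=> [Aw Bw] i _; rewrite /A' /=; case: eqP => [->//|_]; exact: Aw.
  move=> Aw; split.
    move=> i _; have := Aw i Logic.I; rewrite /A' /=; case: eqP => // ->.
    by rewrite Aj.
  by have := Aw j0 Logic.I; rewrite /A' /= eqxx.
rewrite !indep//; last by move=> i; rewrite /A'; case: ifP.
rewrite (bigD1 j0)//= [in RHS](bigD1 j0)//= /A' eqxx Aj preimage_setT.
rewrite probability_setT mul1e; congr (_ * _).
by apply: eq_bigr => i /negbTE ->.
Qed.

(** Both sides are finite measures in [E] agreeing on the pi-system [cyl], hence on the
    sigma-algebra it generates. *)
Let sigma_cyl_indep E B : <<s cyl >> E -> measurable B ->
  P (E `&` X j0 @^-1` B) = P (X j0 @^-1` B) * P E.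
Proof.
move=> sE mB.
have mXB : measurable (X j0 @^-1` B) by rewrite -[_ @^-1` _]setTI; exact: mX.
have fB : P (X j0 @^-1` B) \is a fin_num by exact: fin_num_measure.
have p0 : (0 <= fine (P (X j0 @^-1` B)))%R by rewrite fine_ge0.
have scE F : mscale (NngNum p0) P F = P (X j0 @^-1` B) * P F.
  by rewrite /mscale -[in RHS](fineK fB).
rewrite -scE.
apply: (@g_sigma_algebra_measure_unique _ R _ cyl measurable_cyl (fun=> setT)
  (fun=> cylT) _ (mrestr P mXB) (mscale (NngNum p0) P) cylI _ _ E sE).
- by rewrite bigcup_const.
- by move=> A cA; apply: (etrans (cyl_indep cA mB)); exact/esym/scE.
- by move=> _; rewrite /= /mrestr setTI -ge0_fin_numE// fin_num_measure.
Qed.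

(** A linear combination of coordinates other than [j0] is measurable for the sigma-algebra
    generated by [cyl]. *)
Lemma independent_of_linear_combination (n : nat) (c : 'I_n -> R) (j : 'I_n -> I) A B :
  (forall k, j k != j0) -> measurable A -> measurable B ->
  P ((fun w => \sum_(k < n) c k * X (j k) w)%R @^-1` A `&` X j0 @^-1` B) =
  P ((fun w => \sum_(k < n) c k * X (j k) w)%R @^-1` A) * P (X j0 @^-1` B).
Proof.
move=> jj0 mA mB; rewrite [RHS]muleC; apply: sigma_cyl_indep => //.
have mXj k : measurable_fun [set: g_sigma_algebraType cyl] (X (j k)).
  move=> _ C mC; rewrite setTI; apply: sub_gen_smallest.
  exact: cyl_preimage.
have := @measurable_sum _ (g_sigma_algebraType cyl) R setT _ (index_enum 'I_n)
  (fun k w => c k * X (j k) w)%R.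
move=> /(_ _)-/(_ (fun k => measurable_funM (measurable_cst _) (mXj k))).
by move=> /(_ measurableT A mA); rewrite setTI.
Qed.

End Family.

(** The joint law is the product of the law of [u] and [Q], since both agree on rectangles; Tonelli
    then gives the iterated integral. *)
Lemma integral_independent_pair {d1 d2} {T1 : measurableType d1}
    {T2 : measurableType d2} (u : Omega -> T1) (v : Omega -> T2) (F : T1 * T2 -> \bar R)
    (mu' : measurable_fun setT u) (mv : measurable_fun setT v)
    (Q : probability T2 R) :
  (forall A B, measurable A -> measurable B ->
     P (u @^-1` A `&` v @^-1` B) = P (u @^-1` A) * P (v @^-1` B)) ->
  (forall B, measurable B -> P (v @^-1` B) = Q B) ->
  measurable_fun setT F -> (forall p, 0 <= F p) ->
  \int[P]_w F (u w, v w) = \int[P]_w \int[Q]_y F (u w, y).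
Proof.
move=> huv hv mF F0.
pose U : {RV P >-> T1} := mfun_Sub (mem_set mu' : u \in mfun).
have muv : measurable_fun setT (fun w => (u w, v w)) by exact/measurable_fun_pairP.
pose UV : {RV P >-> (T1 * T2)%type} := mfun_Sub (mem_set muv : (fun w => (u w, v w)) \in mfun).
have E : forall X, measurable X -> (distribution P U \x Q) X = distribution P UV X.
  apply: product_measure_unique => A B mA mB.
  rewrite /distribution /pushforward/= -hv//; exact: huv.
transitivity (\int[distribution P UV]_p F p).
  by rewrite ge0_integral_distribution.
transitivity (\int[distribution P U \x Q]_p F p).
  by apply: eq_measure_integral => A mA _; apply/esym/E.
rewrite fubini_tonelli1// ge0_integral_distribution//.
- exact: measurable_fun_fubini_tonelli_F.
- by move=> x; apply: integral_ge0.
Qed.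

End Independence.

(** * Numerical bounds for the exponential *)

Section ExpBounds.
Context {R : realType}.

Lemma sinh_ge (y : R) : 0 <= y -> 2 * y <= expR y - expR (- y).
Proof.
move=> y0; rewrite -subr_le0.
pose g (s : R) := 2 * s - (expR s - expR (- s)).
have gd (s : R) : is_derive s 1 g (2 - (expR s + expR (- s))).
  have d1 := is_derive_mull 2 (is_derive_id s (1 : R)).
  have d2 := @is_derive1_comp _ expR -%R s _ _ (is_derive_expR _) (is_deriveNid s 1).
  apply: (is_derive_eq (is_deriveB d1 (is_deriveB (is_derive_expR s) d2))).
  by rewrite mulr1 mulrN1 opprK.
have := @nonincreasing_from0 _ g _ y y gd.
rewrite /g mulr0 oppr0 !subrr; apply; last by rewrite y0 lexx.
move=> s _; rewrite expRN; have e0 := expR_gt0 s.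
rewrite -oppr_ge0.
have -> : - (2 - (expR s + (expR s)^-1)) = (expR s)^-1 * (expR s - 1) ^+ 2.
  by field; rewrite gt_eqF.
by rewrite mulr_ge0 ?sqr_ge0// invr_ge0 ltW.
Qed.

(** [e^x + e^(-x) - 2] is the square of [e^(x/2) - e^(-x/2)], which [sinh_ge] bounds below by
    [x]. *)
Lemma cosh_ge (x : R) : 2 + x ^+ 2 <= expR x + expR (- x).
Proof.
wlog x0 : x / 0 <= x => [H|].
  have [/H//|/ltW x0] := leP 0 x.
  by have := H (- x); rewrite oppr_ge0 => /(_ x0); rewrite opprK sqrrN addrC [leRHS]addrC addrC.
have h : 2 * (x / 2) <= expR (x / 2) - expR (- (x / 2)) by apply: sinh_ge; lra.
have -> : expR x = expR (x / 2) * expR (x / 2).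
  by rewrite -expRD; congr expR; lra.
have -> : expR (- x) = expR (- (x / 2)) * expR (- (x / 2)).
  by rewrite -expRD; congr expR; lra.
have := expRxMexpNx_1 (x / 2).
have := ler_pM _ _ h h; rewrite mulr_ge0// ?divr_ge0// => /(_ isT isT).
lra.
Qed.

(** Rational upper bounds start at [1/16] and [-1/16], from [1 + x <= e^x], and propagate by
    doubling the argument. *)
Lemma expR_double_le (x b d : R) : expR x <= b -> b * b <= d -> expR (x + x) <= d.
Proof. by move=> xb /(le_trans _); apply; rewrite expRD ler_pM ?expR_ge0. Qed.

Lemma expR_eighth_le : expR (1 / 8) <= 569 / 500 :> R.
Proof.
have -> : 1 / 8 = 1 / 16 + 1 / 16 :> R by lra.
apply: (@expR_double_le _ (16 / 15)); last by lra.
have := ler_wpM2l (expR_ge0 (1 / 16)) (expR_ge1Dx (- (1 / 16) : R)).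
rewrite expRxMexpNx_1; lra.
Qed.

Lemma expRN_eighth_le : expR (- (1 / 8)) <= 443 / 500 :> R.
Proof.
have -> : - (1 / 8) = - (1 / 16) + - (1 / 16) :> R by lra.
apply: (@expR_double_le _ (16 / 17)); last by lra.
have := ler_wpM2l (expR_ge0 (- (1 / 16))) (expR_ge1Dx (1 / 16 : R)).
rewrite mulrC [leRHS]mulrC expRxMexpNx_1; lra.
Qed.

Lemma expR_half_le : expR (1 / 2) <= 42 / 25 :> R.
Proof.
have -> : 1 / 2 = 1 / 4 + 1 / 4 :> R by lra.
apply: (@expR_double_le _ (162 / 125)); last by lra.
have -> : 1 / 4 = 1 / 8 + 1 / 8 :> R by lra.
by apply: (expR_double_le expR_eighth_le); lra.
Qed.

Lemma expRN_quarter_le : expR (- (1 / 4)) <= 157 / 200 :> R.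
Proof.
have -> : - (1 / 4) = - (1 / 8) + - (1 / 8) :> R by lra.
by apply: (expR_double_le expRN_eighth_le); lra.
Qed.

Lemma expR_eighths : expR (5 / 8) + expR (- (3 / 8)) <= 261 / 100 :> R.
Proof.
have -> : 5 / 8 = 1 / 2 + 1 / 8 :> R by lra.
have -> : - (3 / 8) = - (1 / 4) + - (1 / 8) :> R by lra.
rewrite !expRD.
have h1 := ler_pM (expR_ge0 _) (expR_ge0 _) expR_half_le expR_eighth_le.
have h2 := ler_pM (expR_ge0 _) (expR_ge0 _) expRN_quarter_le expRN_eighth_le.
lra.
Qed.

Lemma phi01_ratio (x a : R) :
  phi01 (x + a) / phi01 x = expR (- (a * x + a ^+ 2 / 2)).
Proof.
rewrite /phi01 invfM invrK mulrACA mulVf ?mulr1; last first.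
  by rewrite sqrtr_eq0 -ltNge pmulrn_lgt0// pi_gt0.
by rewrite -expRN -expRD; congr expR; field.
Qed.

End ExpBounds.

(** * Gaussian projection and expected cost of a reflection *)

Section Reflection.
Local Open Scope ereal_scope.
Context {d0} {Omega : measurableType d0} {R : realType} (P : probability Omega R).
Variables (I : finType) (X : I -> Omega -> R).
Hypothesis indep : mutually_independent P X.
Hypothesis mX : forall i, measurable_fun setT (X i).

Let measurable_comb (n : nat) (c : 'I_n -> R) (j : 'I_n -> I) :
  measurable_fun setT (fun w => \sum_(k < n) c k * X (j k) w)%R.
Proof. by apply: measurable_sum => k; exact: measurable_funM. Qed.

(** Induction on [n]: the last coordinate is independent of the partial sum because [j] is
    injective, so it can be integrated out with [normal_mgf]. *)
Lemma gaussian_comb_mgf (h : R) (n : nat) (c : 'I_n -> R) (j : 'I_n -> I) :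
  injective j ->
  (forall k A, measurable A -> P (X (j k) @^-1` A) = normal_prob 0 1 A) ->
  \int[P]_w (expR (h * \sum_(k < n) c k * X (j k) w))%:E =
  (expR (h ^+ 2 * (\sum_(k < n) c k ^+ 2) / 2))%:E.
Proof.
elim: n c j => [|n IH] c j inj lawX.
  under eq_integral do rewrite big_ord0 mulr0 expR0.
  by rewrite big_ord0 mulr0 mul0r expR0 probability_integral_cst.
pose w0 := widen_ord (leqnSn n).
pose u w := (\sum_(k < n) c (w0 k) * X (j (w0 k)) w)%R.
pose F (p : R * measurableTypeR R) := (expR (h * (p.1 + c ord_max * p.2)))%:E.
have mF : measurable_fun setT F.
  apply/measurable_EFinP; apply: measurableT_comp => //.
  apply: measurable_funM => //; apply: measurable_funD => //.
  exact: measurable_funM.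
transitivity (\int[P]_w F (u w, X (j ord_max) w)).
  by apply: eq_integral => w _; rewrite big_ord_recr.
have jw0 k : j (w0 k) != j ord_max.
  by apply/eqP => /inj/(congr1 val)/=; move: (ltn_ord k) => /[swap] ->; rewrite ltnn.
rewrite (integral_independent_pair (T2 := measurableTypeR R) (Q := normal_prob (0 : R) 1) (measurable_comb _ _) (mX _)
  (fun A B mA mB => independent_of_linear_combination indep mX (fun k => c (w0 k)) jw0 mA mB)
  (lawX ord_max) mF) => [|p]; last by rewrite lee_fin expR_ge0.
transitivity (\int[P]_w ((expR (h ^+ 2 * c ord_max ^+ 2 / 2))%:E * (expR (h * u w))%:E)).
  apply: eq_integral => w _.
  transitivity (\int[normal_prob 0 1]_y ((expR (h * u w))%:E * (expR (h * c ord_max * y))%:E)).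
    by apply: eq_integral => y _; rewrite /F/= mulrDr expRD EFinM mulrA.
  rewrite ge0_integral_scale ?expR_ge0//.
    by rewrite normal_mgf exprMn muleC.
  by apply: measurableT_comp => //; exact: measurable_funM.
rewrite ge0_integral_scale ?expR_ge0//; last first.
  by apply: measurableT_comp => //; apply: measurable_funM => //; exact: measurable_comb.
rewrite (IH (fun k => c (w0 k)) (fun k => j (w0 k))); last 2 first.
- by move=> k l /inj/(congr1 val)/= kl; exact: val_inj.
- by move=> k; exact: lawX.
rewrite -EFinM -expRD big_ord_recr/=; congr (expR _)%:E.
by rewrite -/w0; ring.
Qed.

Variables (n : nat) (c : 'I_n -> R) (j : 'I_n -> I) (j0 : I).
Hypothesis j_inj : injective j.
Hypothesis jj0 : forall k, j k != j0.
Hypothesis lawX : forall k A, measurable A -> P (X (j k) @^-1` A) = normal_prob 0 1 A.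
Hypothesis lawV : forall A, measurable A -> P (X j0 @^-1` A) = uniform_prob (@ltr01 R) A.
Hypothesis c1 : (\sum_(k < n) c k ^+ 2 = 1)%R.

Let u w := (\sum_(k < n) c k * X (j k) w)%R.

Let mu_ : measurable_fun setT u. Proof. exact: measurable_comb. Qed.

(** [cosh_ge] at [(u + 1) / 2] bounds [(u + 1)^2 + 8] by exponentials whose expectation is
    [4 (e^(5/8) + e^(-3/8)) <= 261/25]; subtracting [8] leaves [61/25]. *)
Lemma gaussian_shifted_square : \int[P]_w ((u w + 1) ^+ 2)%:E <= (61 / 25 : R)%:E.
Proof.
have mgf (h : R) : measurable_fun setT (fun w => (expR (h * u w))%:E).
  apply/measurable_EFinP; apply: measurableT_comp => //.
  exact: measurable_funM.
have m2 : measurable_fun setT (fun w => ((u w + 1) ^+ 2)%:E).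
  apply/measurable_EFinP; apply: measurable_funX; exact: measurable_funD.
suff : \int[P]_w ((u w + 1) ^+ 2)%:E + (8 : R)%:E <= (261 / 25 : R)%:E.
  rewrite -leeBrDr// -EFinB => /le_trans; apply; rewrite lee_fin; lra.
have -> : (8 : R)%:E = \int[P]_w (8 : R)%:E.
  by rewrite probability_integral_cst.
rewrite -ge0_integralD//; last by move=> w _; rewrite lee_fin sqr_ge0.
apply: (@le_trans _ _ (\int[P]_w ((4 * expR (1 / 2))%:E * (expR (1 / 2 * u w))%:E +
    (4 * expR (- (1 / 2)))%:E * (expR (- (1 / 2) * u w))%:E))).
  apply: ge0_integral_mono => w.
    by rewrite -EFinD lee_fin addr_ge0// sqr_ge0.
  rewrite -!EFinM -!EFinD lee_fin.
  have e1 : (expR ((u w + 1) / 2) = expR (1 / 2) * expR (1 / 2 * u w))%R.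
    by rewrite -expRD; congr expR; lra.
  have e2 : (expR (- ((u w + 1) / 2)) = expR (- (1 / 2)) * expR (- (1 / 2) * u w))%R.
    by rewrite -expRD; congr expR; lra.
  by have := cosh_ge ((u w + 1) / 2); rewrite e1 e2 expr_div_n; lra.
have mgfE (k h : R) : measurable_fun setT (fun w => k%:E * (expR (h * u w))%:E).
  exact: emeasurable_funM.
have mgf0 (k h : R) w : (0 <= k)%R -> 0 <= k%:E * (expR (h * u w))%:E.
  by move=> k0; rewrite mule_ge0 ?lee_fin ?expR_ge0.
rewrite ge0_integralD => [|//|w _|//|w _|//]; last 2 first.
- by rewrite mgf0// mulr_ge0// expR_ge0.
- by rewrite mgf0// mulr_ge0// expR_ge0.
have mgfR (h : R) : measurable_fun setT (fun w => expR (h * u w)).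
  by apply: measurableT_comp => //; exact: measurable_funM.
rewrite !ge0_integral_scale ?mulr_ge0 ?expR_ge0//.
rewrite !gaussian_comb_mgf// c1 -!EFinM -EFinD lee_fin.
have e1 : (expR (5 / 8) = expR (1 / 2) * expR ((1 / 2) ^+ 2 * 1 / 2) :> R)%R.
  by rewrite -expRD; congr expR; lra.
have e2 : (expR (- (3 / 8)) = expR (- (1 / 2)) * expR ((- (1 / 2)) ^+ 2 * 1 / 2) :> R)%R.
  by rewrite -expRD; congr expR; lra.
by have := @expR_eighths R; rewrite e1 e2; lra.
Qed.

(* Conditionally on [u], the reflection has probability
   [(1 - phi (u + a) / phi u)^+ <= a (u + a / 2)^+]. *)
Lemma reflection_integral_le (a A : R) (g : R -> R) :
  (0 <= a)%R -> (a <= 1 / 4)%R -> measurable_fun setT g -> (forall x, 0 <= g x)%R ->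
  (forall x, 0 <= x + 1 / 8 -> (x + 1 / 8) * g x <= A * (x + 1) ^+ 2)%R -> (0 <= A)%R ->
  \int[P]_w (if (X j0 w <= phi01 (u w + a) / phi01 (u w))%R then 0%R else g (u w))%:E
    <= (61 / 25 * A * a)%:E.
Proof.
move=> a0 a4 mg g0 gA A0.
pose r x := expR (- (a * x + a ^+ 2 / 2)).
have rE x : (phi01 (x + a) / phi01 x = r x)%R by exact: phi01_ratio.
under eq_integral do rewrite rE.
pose F (p : R * measurableTypeR R) := (if (p.2 <= r p.1)%R then 0%R else g p.1)%:E.
have mr : measurable_fun setT r.
  apply: measurableT_comp => //; apply: measurableT_comp => //.
  by apply: measurable_funD => //; exact: measurable_funM.
have mF : measurable_fun setT F.
  apply/measurable_EFinP; apply: measurable_fun_ifT => //.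
    by apply: measurable_fun_ler => //; exact: measurableT_comp.
  exact: measurableT_comp.
rewrite (integral_independent_pair (T2 := measurableTypeR R) (Q := uniform_prob (@ltr01 R)) mu_ (mX j0)
  (fun A B mA mB => independent_of_linear_combination indep mX c jj0 mA mB)
  lawV mF) => [|p]; last by rewrite lee_fin; case: ifP.
apply: (@le_trans _ _ (\int[P]_w ((a * A)%:E * ((u w + 1) ^+ 2)%:E))).
  apply: ge0_integral_mono => w.
    by apply: integral_ge0 => y _; rewrite lee_fin; case: ifP.
  set x := u w.
  (* Given [u = x], only the rejection event [y > r x] contributes. *)
  have -> : \int[uniform_prob ltr01]_y F (x, y) =
      (g x)%:E * uniform_prob (@ltr01 R) `]r x, +oo[.
    transitivity ((g x)%:E *
        \int[uniform_prob ltr01]_y (\1_(`]r x, +oo[%classic : set R) y)%:E); last first.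
      by rewrite integral_indic// setIT.
    rewrite -ge0_integral_scale//.
    apply: eq_integral => y _; rewrite /F/= indicE mem_setE in_itv/= andbT.
    by rewrite -EFinM ltNge; case: (y <= r x)%R; rewrite ?mulr0 ?mulr1.
  apply: (@le_trans _ _ ((g x)%:E * (Num.max 0 (1 - r x))%:E)).
    by apply: lee_wpmul2l; [rewrite lee_fin|apply: uniform_tail; exact: expR_ge0].
  rewrite -!EFinM lee_fin.
  (* From [1 - e^(-y) <= y] with [y = a x + a^2 / 2], and [a <= 1/4]. *)
  have r1 : (1 - r x <= a * (x + 1 / 8))%R.
    have := expR_ge1Dx (- (a * x + a ^+ 2 / 2)); rewrite -/(r x) => h.
    have : (a * a <= a * (1 / 4))%R by rewrite ler_wpM2l.
    move: h; rewrite expr2; lra.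
  have [x8|x8] := leP 0%R (x + 1 / 8)%R; last first.
    rewrite max_l; last by rewrite (le_trans r1)// mulr_ge0_le0// ltW.
    by rewrite mulr0 mulr_ge0 ?sqr_ge0// mulr_ge0.
  apply: (@le_trans _ _ (g x * (a * (x + 1 / 8)))%R).
    by rewrite ler_wpM2l// ge_max mulr_ge0//= r1.
  rewrite mulrCA -[leRHS]mulrA (ler_wpM2l a0)// mulrC; exact: gA.
rewrite ge0_integral_scale ?mulr_ge0//.
- apply: (@le_trans _ _ ((a * A)%:E * (61 / 25 : R)%:E)).
    apply: lee_wpmul2l; first by rewrite lee_fin mulr_ge0.
    exact: gaussian_shifted_square.
  by rewrite -EFinM lee_fin; lra.
- by apply: measurable_funX; exact: measurable_funD.
- by move=> w; rewrite sqr_ge0.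
Qed.

End Reflection.

(** * Constants *)

Section Constants.
Context {R : realType}.
Variables (L K calR T e : R).
Hypothesis L0 : 0 < L.
Hypothesis K0 : 0 < K.
Hypothesis calR0 : 0 <= calR.
Hypothesis T0 : 0 < T.
Hypothesis KL : K <= L / 4.
Hypothesis hstep : L * T ^+ 2 <= 3 / 5 * stepMin L K calR.

Local Notation Rt := (Rtilde L K calR).
Local Notation R1 := (R1 L K calR T).
Local Notation ga := (gammaC L K calR T).
Local Notation E := (expR (- R1 / T)).

Lemma Rtilde_ge0 : 0 <= Rt.
Proof. by rewrite /Rtilde mulr_ge0// sqrtr_ge0. Qed.

Lemma R1_ge0 : 0 <= R1.
Proof.
by rewrite /Defs.R1 mulr_ge0// addr_ge0 ?Rtilde_ge0// mulr_ge0// ltW.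
Qed.

(** [K <= L / 4] makes the ratio under the root at least [3/2], which exceeds [(100/82)^2]. Thus
    [r >= Rt] gives the room that [parallel_contraction] requires. *)
Lemma calR_le : calR <= 82 / 100 * Rt.
Proof.
have q : (100 / 82) ^+ 2 <= (2 * L + K) / (6 * K).
  by rewrite ler_pdivlMr ?mulr_gt0//; move: KL K0; lra.
have s : 100 / 82 <= Num.sqrt ((2 * L + K) / (6 * K)).
  rewrite -[leLHS]ger0_norm; last by lra.
  by rewrite -sqrtr_sqr ler_wsqrtr.
by rewrite /Rtilde; have := ler_wpM2r calR0 s; lra.
Qed.

Lemma LT2_le : L * T ^+ 2 <= 3 / 20.
Proof.
apply: (le_trans hstep); rewrite /stepMin.
have h (m : R) : m <= 1 / 4 -> 3 / 5 * m <= 3 / 20 by lra.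
by apply: h; case: ifP => // _; rewrite ge_min lexx.
Qed.

Lemma KT2_le : K * T ^+ 2 <= 3 / 80.
Proof. have := ler_wpM2r (sqr_ge0 T) KL; have := LT2_le; lra. Qed.

(** For the last bound, if the minimum is [1 / (4 Rt)], the second term of [stepMin] gives
    [(L T Rt)^2 <= (3/80)^2]; multiplying [L T Rt <= 3/80] by [T / Rt] concludes. *)
Lemma gamma_props : 0 < Rt ->
  [/\ 0 <= ga, ga * T <= 1, ga * Rt <= 1 / 4 & L * T ^+ 2 <= 3 / 20 * (ga * T)].
Proof.
move=> Rt0; have Rtn0 : Rt == 0 = false by rewrite gt_eqF.
have T1 : T^-1 * T = 1 by rewrite mulVf// gt_eqF.
have Rt1 : Rt^-1 * Rt = 1 by rewrite mulVf// gt_eqF.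
have gE : ga = Num.min T^-1 (Rt^-1 / 4) by rewrite /gammaC Rtn0.
have g1 : ga <= T^-1 by rewrite gE ge_min lexx.
have g2 : ga <= Rt^-1 / 4 by rewrite gE ge_min lexx orbT.
split.
- by rewrite gE le_min invr_ge0 ltW//= divr_ge0// invr_ge0 ltW.
- by have := ler_wpM2r (ltW T0) g1; rewrite T1.
- by have := ler_wpM2r (ltW Rt0) g2; rewrite mulrAC Rt1.
rewrite gE; case: (leP T^-1 (Rt^-1 / 4)) => _; first by rewrite T1 mulr1 LT2_le.
have h : L * T ^+ 2 <= 3 / 5 * (3 / (1280 * L * Rt ^+ 2)).
  apply: (le_trans hstep); rewrite ler_wpM2l//.
  by rewrite /stepMin Rtn0 ge_min lexx orbT.
have LR0 : 0 < L * Rt by rewrite mulr_gt0.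
have h2 : (L * T * Rt) ^+ 2 <= (3 / 80) ^+ 2.
  have := ler_wpM2r (ltW (mulr_gt0 LR0 Rt0)) h.
  have -> : 3 / 5 * (3 / (1280 * L * Rt ^+ 2)) * (L * Rt * Rt) = 9 / 6400.
    by field; rewrite !gt_eqF.
  lra.
have h3 : L * T * Rt <= 3 / 80.
  rewrite -(@ler_pXn2r _ 2) ?nnegrE//.
  by rewrite !mulr_ge0// ltW.
have iR0 : 0 <= T * Rt^-1 by rewrite mulr_ge0 ?invr_ge0 ?ltW.
have := ler_wpM2r iR0 h3.
have -> : L * T * Rt * (T * Rt^-1) = L * T ^+ 2 * (Rt^-1 * Rt) by ring.
by rewrite Rt1 mulr1; lra.
Qed.

Lemma R1_T : R1 / T = 5 * Rt / (4 * T) + 5 / 2.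
Proof. by rewrite /Defs.R1; field; rewrite gt_eqF. Qed.

Lemma exp_five_half_ge : 10 <= expR (5 / 2) :> R.
Proof.
have -> : 5 / 2 = 20%:R * (1 / 8) :> R by lra.
rewrite expRM_natl.
have h : 9 / 8 <= expR (1 / 8) :> R by have := expR_ge1Dx (1 / 8 : R); lra.
have -> : expR (1 / 8) ^+ 20 = (expR (1 / 8) ^+ 4) ^+ 5 :> R by rewrite -exprM.
have h4 : 8 / 5 <= expR (1 / 8) ^+ 4 :> R.
  have := @lerXn2r R 4 (9 / 8) (expR (1 / 8)).
  by rewrite !nnegrE expR_ge0 => /(_ _ isT h); lra.
have := @lerXn2r R 5 (8 / 5) (expR (1 / 8) ^+ 4).
by rewrite !nnegrE exprn_ge0 ?expR_ge0// => /(_ _ isT h4); lra.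
Qed.

Lemma exp_five_half_le : expR (5 / 2) <= 15 :> R.
Proof.
have -> : 5 / 2 = 20%:R * (1 / 8) :> R by lra.
rewrite expRM_natl.
have h := @expR_eighth_le R.
have -> : expR (1 / 8) ^+ 20 = (expR (1 / 8) ^+ 4) ^+ 5 :> R by rewrite -exprM.
have h4 : expR (1 / 8) ^+ 4 <= 17 / 10 :> R.
  have := @lerXn2r R 4 (expR (1 / 8)) (569 / 500).
  by rewrite !nnegrE expR_ge0 => /(_ isT _ h); lra.
have := @lerXn2r R 5 (expR (1 / 8) ^+ 4) (17 / 10).
by rewrite !nnegrE exprn_ge0 ?expR_ge0// => /(_ isT _ h4); lra.
Qed.

(** [R1 - r >= 5/2 T], so the slope of [f] beyond [R1] carries an extra factor
    [e^(-5/2) <= 1/10]. *)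
Lemma tail_slope (r : R) : r <= Rt -> E <= expR (- r / T) / 10.
Proof.
move=> rR.
have : E <= expR (- r / T) * expR (- (5 / 2)).
  rewrite -expRD ler_expR -(ler_pM2r T0) mulrDl !mulNr !divfK ?gt_eqF//.
  by rewrite /Defs.R1; have := Rtilde_ge0; lra.
move=> /le_trans; apply; rewrite ler_wpM2l ?expR_ge0// expRN.
by rewrite lef_pV2 ?posrE ?expR_gt0 ?exp_five_half_ge.
Qed.

Lemma E_le : E <= 1 / 10.
Proof. by have := tail_slope Rtilde_ge0; rewrite oppr0 mul0r expR0. Qed.

(** The exponential in the rate is [e^(5/2) E <= 15 E], and [15/156 <= 0.097]. All gains and losses
    are later compared in units of [K T^2 E]. *)
Lemma rate_le : K * T ^+ 2 / 156 * expR (- (5 * Rt / (4 * T))) <=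
  97 / 1000 * (K * T ^+ 2 * E).
Proof.
have -> : expR (- (5 * Rt / (4 * T))) = E * expR (5 / 2).
  by rewrite -expRD mulNr R1_T; congr expR; lra.
have KT : 0 <= K * T ^+ 2 * E by rewrite !mulr_ge0 ?expR_ge0 ?ltW.
have := ler_wpM2l KT exp_five_half_le; lra.
Qed.

Hypothesis he : e <= 5 / 64 * (K / Num.sqrt (7 / 6 + 3 / (2 * K * T ^+ 2)))
                        * expR (- (5 * Rt / (2 * T)) - 5).

(** The exponential is exactly [E^2], and [K T^2 <= 3/80] makes the quantity under the root at least
    [40], so the root is at least [6]. *)
Lemma interaction_le : e <= 5 / 384 * (K * E ^+ 2).
Proof.
apply: (le_trans he).
have -> : expR (- (5 * Rt / (2 * T)) - 5) = E ^+ 2.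
  rewrite expr2 -expRD mulNr R1_T; congr expR.
  by field; rewrite gt_eqF.
rewrite [leRHS](_ : _ = 5 / 64 * (K / 6) * E ^+ 2); last by field.
rewrite ler_wpM2r ?sqr_ge0// ler_wpM2l//.
rewrite ler_wpM2l ?(ltW K0)// lef_pV2 ?posrE//; last first.
  by rewrite sqrtr_gt0 addr_gt0// ?divr_gt0// !mulr_gt0// exprn_gt0.
rewrite [leLHS](_ : 6 = Num.sqrt (6 ^+ 2)); last by rewrite sqrtr_sqr ger0_norm.
apply: ler_wsqrtr.
have KT0 : 0 < 2 * K * T ^+ 2 by rewrite !mulr_gt0// exprn_gt0.
have h40 : 40 <= 3 / (2 * K * T ^+ 2).
  by rewrite ler_pdivlMr//; have := KT2_le; lra.
by move: h40; set y := 3 / _; lra.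
Qed.

Lemma interaction_le_K : e <= K / 1000.
Proof.
apply: (le_trans interaction_le).
have h : E ^+ 2 <= (1 / 10) ^+ 2.
  by rewrite lerXn2r ?nnegrE ?expR_ge0 ?E_le//; lra.
have := ler_wpM2l (ltW K0) h; move: K0; lra.
Qed.

End Constants.

(** * Estimates for the coupled flow *)

Section FlowEstimates.
Context {R : realType} {N d : nat}.
Variables (V : 'rV[R]_d -> R) (W : 'rV[R]_d -> 'rV[R]_d -> R).
Variables (gradV : 'rV[R]_d -> 'rV[R]_d) (gradW1 : 'rV[R]_d -> 'rV[R]_d -> 'rV[R]_d).
Variables (L K calR Lt T eps : R).
Hypothesis hV_grad : forall x, is_gradient V x (gradV x).
Hypothesis hW_diff : forall p : 'rV[R]_d * 'rV[R]_d, differentiable (fun q => W q.1 q.2) p.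
Hypothesis hW_grad1 : forall x y, is_gradient (fun z => W z y) x (gradW1 x y).
Hypothesis hL : 0 < L.
Hypothesis hK : 0 < K.
Hypothesis hLt : 0 <= Lt.
Hypothesis hVlip : forall x y, enorm (gradV x - gradV y) <= L * enorm (x - y).
Hypothesis hVconv : forall x y, calR <= enorm (x - y) ->
  K * enorm (x - y) ^+ 2 + L^-1 * enorm (gradV x - gradV y) ^+ 2 <=
  frob (x - y) (gradV x - gradV y).
Hypothesis hWsym : forall x y, W x y = W y x.
Hypothesis hWlip : forall x y x' y',
  enorm (gradW1 x y - gradW1 x' y') <= Lt * (enorm (x - x') + enorm (y - y')).

(* Cocoercivity gives [K <= s - s^2 / L <= L / 4] with [s] the ratio of
   [|gradV x - gradV y|] to [|x - y|]. *)
Lemma convexity_le_quarter : (exists v : 'rV[R]_d, enorm v = 1) -> 0 <= calR -> K <= L / 4.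
Proof.
(* The length [calR + 1] makes (c) applicable and stays positive when [calR = 0]. *)
move=> [v v1] R0; pose x := (calR + 1) *: v.
have xr : enorm (x - 0) = calR + 1.
  by rewrite subr0 enormZ v1 mulr1 ger0_norm// addr_ge0.
have hR : calR <= enorm (x - 0) by rewrite xr lerDl.
have := hVconv hR; have := frob_le (x - 0) (gradV x - gradV 0).
rewrite xr; set g := enorm (gradV x - _); set r := calR + 1 => h1 h2.
have r0 : 0 < r by rewrite /r; lra.
have h3 : K * r ^+ 2 + L^-1 * g ^+ 2 <= r * g by exact: le_trans h2 h1.
have h4 : 0 <= L^-1 * (g - L / 2 * r) ^+ 2 by rewrite mulr_ge0 ?sqr_ge0// invr_ge0 ltW.
have h5 : L^-1 * (g - L / 2 * r) ^+ 2 = L^-1 * g ^+ 2 - r * g + L / 4 * r ^+ 2.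
  by field; rewrite gt_eqF.
by rewrite -(ler_pM2r (exprn_gt0 2 r0)); lra.
Qed.

Variables (q p q' p' : R -> 'M[R]_(N, d)).
Hypothesis qd : forall t : R, is_derive t 1 q (p t).
Hypothesis pd : forall t : R, exists g, is_gradient (Upot V W eps) (q t) g /\
  is_derive t 1 p (- g).
Hypothesis qd' : forall t : R, is_derive t 1 q' (p' t).
Hypothesis pd' : forall t : R, exists g, is_gradient (Upot V W eps) (q' t) g /\
  is_derive t 1 p' (- g).
Hypothesis hT : 0 < T.
Hypothesis heps : 0 <= eps.
Hypothesis N0 : (0 < N)%N.

Let z i (t : R) := row i (q t) - row i (q' t).
Let w i (t : R) := row i (p t) - row i (p' t).
Let D i (t : R) := gradV (row i (q t)) - gradV (row i (q' t)).
Let de i (t : R) := (eps / N%:R) *: \sum_(j < N)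
  (gradW1 (row i (q t)) (row j (q t)) - gradW1 (row i (q' t)) (row j (q' t))).

Let zd i (t : R) : is_derive t 1 (z i) (w i t).
Proof. exact: (is_deriveB (is_derive_row i (qd t)) (is_derive_row i (qd' t))). Qed.

Let wd i (t : R) : is_derive t 1 (w i) (- (D i t + de i t)).
Proof.
have [g [Ug gp]] := pd t; have [g' [Ug' gp']] := pd' t.
apply: (is_derive_eq (is_deriveB (is_derive_row i gp) (is_derive_row i gp'))).
rewrite !linearN/= (gradient_Upot_row hV_grad hW_diff hW_grad1 hWsym i Ug).
rewrite (gradient_Upot_row hV_grad hW_diff hW_grad1 hWsym i Ug').
rewrite /D /de sumrB scalerBr; set a := gradV _; set b := gradV _.
set A := _ *: _; set B := _ *: _.
by rewrite opprK addrC -opprB [in RHS]addrACA -opprD.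
Qed.

Let N0r : 0 < N%:R :> R. Proof. by rewrite ltr0n. Qed.

Let de_le i (t : R) :
  enorm (de i t) <= eps * Lt * (enorm (z i t) + N%:R^-1 * \sum_(j < N) enorm (z j t)).
Proof.
have e0 : 0 <= eps / N%:R by rewrite divr_ge0.
rewrite /de enormZ ger0_norm//.
apply: (@le_trans _ _ (eps / N%:R * \sum_(j < N) (Lt * (enorm (z i t) + enorm (z j t))))).
  rewrite ler_wpM2l// (le_trans (enorm_sum _ _ _))//; apply: ler_sum => j _.
  exact: hWlip.
rewrite -mulr_sumr big_split/= sumr_const card_ord -mulr_natl.
rewrite le_eqVlt; apply/orP; left; apply/eqP.
by field; rewrite gt_eqF.
Qed.

Hypothesis LT : L * T ^+ 2 <= 3 / 20.
Hypothesis KL : K <= L / 4.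
Hypothesis eK : eps * Lt <= K / 1000.

Let eL : eps * Lt <= L / 1000. Proof. by move: eK KL hL; lra. Qed.
Let e0 : 0 <= eps * Lt. Proof. exact: mulr_ge0. Qed.

(* [Q] bounds the effect of the interaction on every particle; it is controlled
   by the average of the free displacements [b]. *)
Lemma flow_estimates (b : 'I_N -> R) :
  (forall i (t : R), 0 <= t <= T -> enorm (z i 0 + t *: w i 0) <= b i) ->
  exists Q : R, [/\ 0 <= Q,
    Q <= 11 / 10 * (eps * Lt * T ^+ 2 * (N%:R^-1 * \sum_(i < N) b i)) &
    forall i, [/\ enorm (z i T) <= 109 / 100 * b i + 55 / 100 * Q,
      w i 0 = 0 -> calR <= 82 / 100 * enorm (z i 0) ->
        enorm (z i T) <= enorm (z i 0) - 36 / 100 * (K * T ^+ 2 * enorm (z i 0)) + 16 / 10 * Q &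
      forall ga, w i 0 = - (ga *: z i 0) -> 0 <= ga -> ga * T <= 1 ->
        L * T ^+ 2 <= 3 / 20 * (ga * T) ->
        enorm (z i T) <= enorm (z i 0) - 9 / 10 * (ga * T * enorm (z i 0)) + 6 / 10 * Q]].
Proof.
move=> hb; have T0 := ltW hT.
have maxP i : exists M : R, (exists2 c, 0 <= c <= T & M = enorm (z i c)) /\
    (forall s : R, 0 <= s <= T -> enorm (z i s) <= M).
  have [c cT hc] := norm_attains_max (zd i) T0.
  by exists (enorm (z i c)); split => //; exists c.
have [M hM] := choice maxP.
have zM i := (hM i).2; have zMatt i := (hM i).1.
have M0 i : 0 <= M i by rewrite (le_trans (enorm_ge0 (z i 0)))// zM// lexx.
pose Mb := N%:R^-1 * \sum_(i < N) M i.
have iN0 : 0 <= N%:R^-1 :> R by rewrite invr_ge0.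
have Mb0 : 0 <= Mb by rewrite mulr_ge0// sumr_ge0.
have DL i (s : R) : 0 <= s <= T -> enorm (D i s) <= L * enorm (z i s).
  by move=> _; exact: hVlip.
have dee i (s : R) : 0 <= s <= T -> enorm (de i s) <= eps * Lt * (enorm (z i s) + Mb).
  move=> sT; rewrite (le_trans (de_le i s))// ler_wpM2l// lerD2l ler_wpM2l//.
  by apply: ler_sum => j _; exact: zM.
have bound i := max_bound (zd i) (wd i) T0 hL e0 Mb0 LT eL (zM i) (DL i) (dee i) (zMatt i) (hb i).
exists (eps * Lt * T ^+ 2 * Mb); split.
- exact: (mulr_ge0 (mulr_ge0 e0 (sqr_ge0 T)) Mb0).
(* Averaging [max_bound] over the particles gives an inequality for [Mb] alone; its right side
   contains [Mb] with the tiny factor [e T^2], which is absorbed. *)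
- have MbE : Mb <= 109 / 100 * (N%:R^-1 * \sum_(i < N) b i) + 55 / 100 * (eps * Lt * T ^+ 2 * Mb).
    set Y := 55 / 100 * _.
    have : \sum_(i < N) M i <= 109 / 100 * (\sum_(i < N) b i) + N%:R * Y.
      rewrite mulr_sumr [N%:R * _]mulr_natl -[in Y *+ _](card_ord N) -sumr_const -big_split/=.
      by apply: ler_sum => i _; exact: bound.
    move=> /(ler_wpM2l iN0)/le_trans; apply.
    rewrite le_eqVlt; apply/orP; left; apply/eqP.
    by field; rewrite gt_eqF.
  have eT := eT_le LT eL.
  have h0 : 0 <= eps * Lt * T ^+ 2 by rewrite !mulr_ge0// sqr_ge0.
  rewrite [leRHS]mulrCA (ler_wpM2l h0)//.
  have := ler_wpM2r Mb0 eT; move: MbE.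
  set B := N%:R^-1 * _; set y := eps * Lt * T ^+ 2 * Mb.
  have B0 : 0 <= B.
    rewrite mulr_ge0// sumr_ge0// => i _.
    by rewrite (le_trans (enorm_ge0 _) (hb i 0 _))// lexx.
  lra.
- move=> i; split.
  + by rewrite (le_trans (zM i T _) (bound i))// T0 lexx.
  + move=> w0 hR.
    apply: (parallel_contraction (zd i) (wd i) T0 hL e0 Mb0 LT eL (zM i) (DL i) (dee i)
      (zMatt i) w0 (ltW hK) eK KL hR) => s sT; exact: hVconv.
  + move=> ga w0 ga0 gaT LTg.
    exact: (coalescing_bound (zd i) (wd i) T0 hL e0 Mb0 LT eL (zM i) (DL i) (dee i)
      (zMatt i) w0 ga0 gaT LTg).
Qed.

End FlowEstimates.

(** * Contraction budget *)

Section Budget.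
Context {R : realType}.
Variables (L K calR T e : R).
Hypothesis L0 : 0 < L.
Hypothesis K0 : 0 < K.
Hypothesis calR0 : 0 <= calR.
Hypothesis T0 : 0 < T.
Hypothesis KL : K <= L / 4.
Hypothesis hstep : L * T ^+ 2 <= 3 / 5 * stepMin L K calR.
Hypothesis e0 : 0 <= e.

Local Notation Rt := (Rtilde L K calR).
Local Notation R1 := (R1 L K calR T).
Local Notation ga := (gammaC L K calR T).
Local Notation E := (expR (- R1 / T)).
Local Notation f := (fdist L K calR T).
Local Notation rate := (K * T ^+ 2 / 156 * expR (- (5 * Rt / (4 * T)))).

Let R10 : 0 <= R1. Proof. exact: R1_ge0. Qed.

Let Rt_le_R1 : Rt <= R1.
Proof. by rewrite /Defs.R1; have := Rtilde_ge0 L K calR0; move: T0; lra. Qed.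

Let fdist_perturb (s t q : R) : 0 <= s -> 0 <= t -> 0 <= q -> s <= t + q -> f s <= f t + q.
Proof.
move=> s0 t0 q0 stq.
have h1 := fdist_le L K calR T0 s0 stq.
have h2 : f (t + q) - f t <= t + q - t by apply: fdist_lip => //; rewrite lerDl.
lra.
Qed.

(** No upper bound on [r] is available, so the decrease of the distance counts with the minimal
    slope [E]; the interaction counts with slope at most [1]. *)
Lemma rho_far (r s Q : R) : 0 <= r -> 0 <= s -> 0 <= Q ->
  s <= r - 36 / 100 * (K * T ^+ 2 * r) + 16 / 10 * Q ->
  f s <= f r - 36 / 100 * (K * T ^+ 2 * (E * r)) + 16 / 10 * Q.
Proof.
move=> r0 s0 Q0 sr; set t := r - 36 / 100 * (K * T ^+ 2 * r) in sr.
have KT0 : 0 <= K * T ^+ 2 * r by rewrite mulr_ge0// mulr_ge0 ?sqr_ge0// ltW.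
have KT1 : K * T ^+ 2 * r <= 3 / 80 * r by rewrite ler_wpM2r// (KT2_le KL hstep).
have t0 : 0 <= t by rewrite /t; lra.
have tr : t <= r by rewrite /t; lra.
have h1 : f s <= f t + 16 / 10 * Q by apply: fdist_perturb => //; lra.
have h2 := fdist_min_slope L K calR T0 t0 tr.
have h3 : r - t = 36 / 100 * (K * T ^+ 2 * r) by rewrite /t; ring.
rewrite h3 in h2; lra.
Qed.

(** Since [r < Rt <= R1], the decrease counts with slope [exp (- r / T)], the same weight as in the
    loss caused by a reflection. *)
Lemma rho_coalesce (r s Q : R) : 0 <= r -> r < Rt -> 0 <= s -> 0 <= Q ->
  s <= r - 9 / 10 * (ga * T * r) + 6 / 10 * Q ->
  f s <= f r - 9 / 10 * (ga * T * (expR (- r / T) * r)) + 16 / 10 * Q.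
Proof.
move=> r0 rR s0 Q0 sr; set t := r - 9 / 10 * (ga * T * r) in sr.
have [ga0 gaT _ _] := gamma_props L0 calR0 T0 hstep (le_lt_trans r0 rR).
have h0 : 0 <= ga * T * r by rewrite mulr_ge0// mulr_ge0// ltW.
have h1 : ga * T * r <= r by rewrite ler_piMl.
have t0 : 0 <= t by rewrite /t; lra.
have tr : t <= r by rewrite /t; lra.
have h2 : f s <= f t + 6 / 10 * Q by apply: fdist_perturb => //; lra.
have h3 := fdist_slope L K calR T0 t0 tr.
rewrite min_r in h3; last by rewrite (le_trans (ltW rR)).
have h4 : r - t = 9 / 10 * (ga * T * r) by rewrite /t; ring.
rewrite h4 in h3; lra.
Qed.

(** With [near_drop_le], ensures that the deterministic part of the final integrand is
    nonnegative. *)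
Lemma far_drop_le (r : R) : 0 <= r -> 36 / 100 * (K * T ^+ 2 * (E * r)) <= f r.
Proof.
move=> r0; have h1 := fdist_ge_linear L K calR T0 r0.
have pr : 0 <= E * r by rewrite mulr_ge0 ?expR_ge0.
by have := ler_wpM2r pr (KT2_le KL hstep); lra.
Qed.

Lemma near_drop_le (r : R) : 0 <= r -> r < Rt ->
  9 / 10 * (ga * T * (expR (- r / T) * r)) <= f r.
Proof.
move=> r0 rR.
have [ga0 gaT _ _] := gamma_props L0 calR0 T0 hstep (le_lt_trans r0 rR).
have := fdist_slope L K calR T0 (lexx 0) r0; rewrite fdist0 !subr0.
rewrite min_r; last by rewrite (le_trans (ltW rR)).
have pr : 0 <= expR (- r / T) * r by rewrite mulr_ge0 ?expR_ge0.
by have := ler_wpM2r pr gaT; lra.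
Qed.

(** The factor [5/4] matches that of [R1], so [t] exceeds [R1] by at most [5/2 T (|u| - 1)]; the
    tail slope turns [5/2] into [1/4]. *)
Lemma rho_reflect (r s Q u : R) : 0 <= r -> r < Rt -> 0 <= s -> 0 <= Q ->
  s <= 109 / 100 * (r + 2 * T * `|u|) + 55 / 100 * Q ->
  f s <= f r + T * expR (- r / T) * (1 + 1 / 4 * Num.max 0 (`|u| - 1)) + 16 / 10 * Q.
Proof.
move=> r0 rR s0 Q0 sr; set t := 5 / 4 * (r + 2 * T * `|u|).
have Tu : 0 <= 2 * T * `|u| by rewrite !mulr_ge0// ltW.
have t0 : 0 <= t by rewrite /t; lra.
have h1 : f s <= f t + 55 / 100 * Q by apply: fdist_perturb => //; rewrite /t; lra.
have rR1 : r <= R1 by rewrite (le_trans (ltW rR)).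
have h2 := fdist_jump T0 R10 r0 rR1 t0.
have m0 : 0 <= Num.max 0 (`|u| - 1) by rewrite le_max lexx.
have h3 : Num.max 0 (t - R1) <= 5 / 2 * T * Num.max 0 (`|u| - 1).
  rewrite ge_max mulr_ge0 ?m0//=; last by move: T0; lra.
  have : T * (`|u| - 1) <= T * Num.max 0 (`|u| - 1).
    by rewrite (ler_wpM2l (ltW T0))// le_max lexx orbT.
  by rewrite /t /Defs.R1; move: rR; lra.
have h4 := tail_slope calR0 T0 (ltW rR).
have h5 : E * Num.max 0 (t - R1) <= expR (- r / T) / 10 * (5 / 2 * T * Num.max 0 (`|u| - 1)).
  by rewrite ler_pM ?expR_ge0// le_max lexx.
lra.
Qed.

(** Growth condition of [reflection_integral_le] for the cost of a reflection, which includes the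
    gain [9/10 ga r] credited in advance. *)
Lemma reflect_weight (r x : R) : 0 <= r -> r < Rt -> 0 <= x + 1 / 8 ->
  (x + 1 / 8) * (T * expR (- r / T) * (9 / 10 * (ga * r) + 1 + 1 / 4 * Num.max 0 (`|x| - 1))
     + 352 / 100 * (e * T ^+ 3) * `|x|) <=
  (36 / 100 * (T * expR (- r / T)) + 352 / 100 * (e * T ^+ 3)) * (x + 1) ^+ 2.
Proof.
move=> r0 rR x8.
have [ga0 _ gaR _] := gamma_props L0 calR0 T0 hstep (le_lt_trans r0 rR).
have gar : ga * r <= 1 / 4 by rewrite (le_trans _ gaR)// ler_wpM2l// ltW.
have h1 : (x + 1 / 8) * (9 / 10 * (ga * r) + 1 + 1 / 4 * Num.max 0 (`|x| - 1)) <=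
    36 / 100 * (x + 1) ^+ 2.
  have [x1|x1] := leP `|x| 1.
    rewrite max_l ?subr_le0//.
    apply: (@le_trans _ _ ((x + 1 / 8) * (49 / 40))); first by rewrite ler_wpM2l//; lra.
    (* [505/720] minimises the quadratic difference of the two sides; [229/176] does so in the case
       [|x| > 1]. *)
    have h := sqr_ge0 (x - 505 / 720); lra.
  have xp : 0 <= x.
    by rewrite leNgt; apply/negP => xn; move: x1; rewrite ltr0_norm//; lra.
  rewrite ger0_norm// in x1 *; rewrite max_r; last by rewrite subr_ge0 ltW.
  apply: (@le_trans _ _ ((x + 1 / 8) * (49 / 40 + 1 / 4 * (x - 1)))).
    by rewrite ler_wpM2l//; lra.
  by have := sqr_ge0 (x - 229 / 176); lra.
have h2 : (x + 1 / 8) * `|x| <= (x + 1) ^+ 2.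
  have [xp|xn] := leP 0 x; first by rewrite ger0_norm//; have := sqr_ge0 x; lra.
  by rewrite ltr0_norm//; have := sqr_ge0 (x + 1 / 2); lra.
have Tp : 0 <= T * expR (- r / T) by rewrite mulr_ge0 ?expR_ge0// ltW.
have ep : 0 <= 352 / 100 * (e * T ^+ 3).
  by rewrite mulr_ge0// mulr_ge0// exprn_ge0// ltW.
have := ler_wpM2l Tp h1; have := ler_wpM2l ep h2; lra.
Qed.

Hypothesis he : e <= 5 / 64 * (K / Num.sqrt (7 / 6 + 3 / (2 * K * T ^+ 2)))
                        * expR (- (5 * Rt / (2 * T)) - 5).

(** One factor of [E^2] in [interaction_le] pays for replacing [r] by [f r], through
    [E r <= f r]. *)
Let interaction_f (r : R) : 0 <= r ->
  e * T ^+ 2 * r <= 5 / 384 * (K * T ^+ 2 * (E * f r)).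
Proof.
move=> r0.
have h1 := interaction_le K0 T0 KL hstep he.
have Tr : 0 <= T ^+ 2 * r by rewrite mulr_ge0 ?sqr_ge0.
have h2 := ler_wpM2r Tr h1.
have h3 := fdist_ge_linear L K calR T0 r0.
have KE : 0 <= K * T ^+ 2 * E by rewrite !mulr_ge0 ?expR_ge0 ?sqr_ge0// ltW.
have := ler_wpM2l KE h3; lra.
Qed.

Let rate_f (r : R) : 0 <= r -> rate * f r <= 97 / 1000 * (K * T ^+ 2 * (E * f r)).
Proof.
move=> r0; have := ler_wpM2r (fdist_ge0 L K calR T0 r0) (rate_le L calR K0 T0).
lra.
Qed.

Lemma budget_far (r : R) : 0 <= r ->
  f r - 36 / 100 * (K * T ^+ 2 * (E * r)) + 176 / 100 * (e * T ^+ 2 * r) <= (1 - rate) * f r.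
Proof.
move=> r0; have h1 := interaction_f r0; have h2 := rate_f r0.
have KE : 0 <= K * T ^+ 2 * E by rewrite !mulr_ge0 ?expR_ge0 ?sqr_ge0// ltW.
have h3 := ler_wpM2l KE (fdist_le_id T0 R10 r0).
have := mulr_ge0 KE (fdist_ge0 L K calR T0 r0); lra.
Qed.

(** In units of [ga T exp(-r/T) r], reflections cost [61/25 * 0.36 = 0.8784] against a gain of
    [0.9]. The surplus covers rate and interaction, both multiples of [K T^2 E f r], which is at
    most [3/80] units. *)
Lemma budget_near (r : R) : 0 <= r -> r < Rt ->
  f r - 9 / 10 * (ga * T * (expR (- r / T) * r)) + 176 / 100 * (e * T ^+ 2 * r)
    + 61 / 25 * (36 / 100 * (T * expR (- r / T)) + 352 / 100 * (e * T ^+ 3)) * (ga * r)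
  <= (1 - rate) * f r.
Proof.
move=> r0 rR; have h1 := interaction_f r0; have h2 := rate_f r0.
have [ga0 gaT _ LTg] := gamma_props L0 calR0 T0 hstep (le_lt_trans r0 rR).
have KTg : K * T ^+ 2 <= 3 / 80 * (ga * T).
  by have := ler_wpM2r (sqr_ge0 T) KL; lra.
have gT0 : 0 <= ga * T by rewrite mulr_ge0// ltW.
have Ephi : E <= expR (- r / T).
  rewrite ler_expR ler_pM2r ?invr_gt0// lerN2; exact: le_trans (ltW rR) _.
have KT0 : 0 <= K * T ^+ 2 by rewrite mulr_ge0 ?sqr_ge0// ltW.
have f0 := fdist_ge0 L K calR T0 r0.
have E0 : 0 <= E by exact: expR_ge0.
have h3 : K * T ^+ 2 * (E * f r) <= 3 / 80 * (ga * T) * (expR (- r / T) * r).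
  apply: ler_pM => //; first exact: mulr_ge0.
  by apply: ler_pM => //; exact: fdist_le_id.
have h4 : e * T ^+ 2 * r * (ga * T) <= e * T ^+ 2 * r.
  by rewrite ler_piMr// mulr_ge0// mulr_ge0// sqr_ge0.
have h5 : 0 <= ga * T * (expR (- r / T) * r) by rewrite mulr_ge0// mulr_ge0 ?expR_ge0.
have h6 : 61 / 25 * (36 / 100 * (T * expR (- r / T)) + 352 / 100 * (e * T ^+ 3)) * (ga * r) =
  61 / 25 * (36 / 100) * (ga * T * (expR (- r / T) * r)) +
  61 / 25 * (352 / 100) * (e * T ^+ 2 * r * (ga * T)) by ring.
rewrite h6; lra.
Qed.

End Budget.

(** * Pathwise bound and expectation *)

Lemma frob_row_vector {R : realType} {d : nat} (a b : 'rV[R]_d) :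
  frob a b = \sum_(k < d) a 0 k * b 0 k.
Proof. by rewrite /frob big_ord1. Qed.

Unset Implicit Arguments.

Theorem mainTheorem16 (R : realType) (N d : nat)
  (V : 'rV[R]_d -> R) (W : 'rV[R]_d -> 'rV[R]_d -> R)
  (gradV : 'rV[R]_d -> 'rV[R]_d) (gradW1 : 'rV[R]_d -> 'rV[R]_d -> 'rV[R]_d)
  (L K calR Lt T eps : R)
  (* C^1 and gradients *)
  (hV_grad : forall x, is_gradient V x (gradV x))
  (hV_C1 : continuous gradV)
  (hW_diff : forall p : 'rV[R]_d * 'rV[R]_d, differentiable (fun q => W q.1 q.2) p)
  (hW_C1 : forall v : 'rV[R]_d * 'rV[R]_d,
      continuous (fun p => 'D_v (fun q : 'rV[R]_d * 'rV[R]_d => W q.1 q.2) p))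
  (hW_grad1 : forall x y, is_gradient (fun z => W z y) x (gradW1 x y))
  (* constants *)
  (hL : 0 < L) (hK : 0 < K) (hcalR : 0 <= calR) (hLt : 0 <= Lt)
  (* (a) *)
  (hV0 : V 0 = 0) (hVnn : forall x, 0 <= V x)
  (* (b) *)
  (hVlip : forall x y, enorm (gradV x - gradV y) <= L * enorm (x - y))
  (* (c) *)
  (hVconv : forall x y, calR <= enorm (x - y) ->
      frob (x - y) (gradV x - gradV y) >=
      K * enorm (x - y) ^+ 2 + L^-1 * enorm (gradV x - gradV y) ^+ 2)
  (* (d) *)
  (hWsym : forall x y, W x y = W y x)
  (hWlip : forall x y x' y',
      enorm (gradW1 x y - gradW1 x' y') <= Lt * (enorm (x - x') + enorm (y - y')))
  (* exact Hamiltonian flow (q_t, p_t)(x, v) for U *)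
  (qf pf : 'M[R]_(N, d) -> 'M[R]_(N, d) -> R -> 'M[R]_(N, d))
  (hq0 : forall x v, qf x v 0 = x) (hp0 : forall x v, pf x v 0 = v)
  (hqd : forall x v (t : R), is_derive t (1 : R) (qf x v) (pf x v t))
  (hpd : forall x v (t : R), exists g, is_gradient (Upot V W eps) (qf x v t) g /\
                                 is_derive t (1 : R) (pf x v) (- g))
  (* parameters *)
  (hT : 0 < T) (heps : 0 <= eps)
  (hstep : L * T ^+ 2 <= 3 / 5 * stepMin L K calR)
  (heLt : eps * Lt <= 5 / 64 * (K / Num.sqrt (7 / 6 + 3 / (2 * K * T ^+ 2)))
                        * expR (- (5 * Rtilde L K calR / (2 * T)) - 5))
  (* randomness: xi ~ N(0, I_{Nd}), V_1..V_N iid uniform on [0,1], independent of xi *)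
  (d0 : measure_display) (Omega : measurableType d0) (P : probability Omega R)
  (xi : 'I_N -> 'I_d -> {RV P >-> R}) (Vu : 'I_N -> {RV P >-> R})
  (hindep : mutually_independent P
      (fun j : ('I_N * 'I_d) + 'I_N =>
         match j with inl ik => (xi ik.1 ik.2 : Omega -> R) | inr i => (Vu i : Omega -> R) end))
  (hxi_law : forall i k A, measurable A ->
      P ((xi i k : Omega -> R) @^-1` A) = normal_prob 0 1 A)
  (hV_law : forall i A, measurable A ->
      P ((Vu i : Omega -> R) @^-1` A) = uniform_prob (@ltr01 R) A)
  (* arbitrary unit vectors used for e^i when z^i = 0 *)
  (e0 : 'I_N -> 'rV[R]_d) (he0 : forall i, enorm (e0 i) = 1)
  (x x' : 'M[R]_(N, d)) :
  let Rt := Rtilde L K calR in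
  let rhoT := rho L K calR T in
  let c := K * T ^+ 2 / 156 * expR (- (5 * Rt / (4 * T))) in
  let z i := row i x - row i x' in
  let e i := if z i == 0 then e0 i else (enorm (z i))^-1 *: z i in
  let xiM (w : Omega) : 'M[R]_(N, d) := \matrix_(i, k) xi i k w in
  let etaM (w : Omega) : 'M[R]_(N, d) :=
    \matrix_(i, k) eta_i Rt (gammaC L K calR T) (row i (xiM w)) (z i) (e i) (Vu i w) 0 k in
  (\int[P]_w (N%:R^-1 * \sum_(i < N)
       rhoT (row i (qf x (xiM w) T)) (row i (qf x' (etaM w) T)))%:E
   <= ((1 - c) * (N%:R^-1 * \sum_(i < N) rhoT (row i x) (row i x')))%:E)%E.
Proof.
pose Rt := Rtilde L K calR; pose rhoT : 'rV[R]_d -> 'rV[R]_d -> R := rho L K calR T.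
pose c := K * T ^+ 2 / 156 * expR (- (5 * Rt / (4 * T))).
pose z i := row i x - row i x'.
pose e i := if z i == 0 then e0 i else (enorm (z i))^-1 *: z i.
pose xiM (w : Omega) : 'M[R]_(N, d) := \matrix_(i, k) xi i k w.
pose etaM (w : Omega) : 'M[R]_(N, d) :=
  \matrix_(i, k) eta_i Rt (gammaC L K calR T) (row i (xiM w)) (z i) (e i) (Vu i w) 0 k.
change (\int[P]_w (N%:R^-1 * \sum_(i < N)
    rhoT (row i (qf x (xiM w) T)) (row i (qf x' (etaM w) T)))%:E
  <= ((1 - c) * (N%:R^-1 * \sum_(i < N) rhoT (row i x) (row i x')))%:E)%E.
(* For [N = 0] both sides vanish; otherwise [e0] at some particle supplies the unit vector from
   which [K <= L / 4] follows. *)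
have [N0|N0] := posnP N.
  have E0 (F : 'I_N -> R) : N%:R^-1 * (\sum_(i < N) F i) = 0.
    by rewrite big1 ?mulr0// => -[m mN] _; exfalso; have := mN; rewrite N0 ltn0.
  apply: (@le_trans _ _ (\int[P]_w 0)%E).
    by apply: ge0_integral_mono => w; rewrite E0.
  by rewrite integral0 E0 (mulr0 (1 - c)).
pose i0 := Ordinal N0.
have KL : K <= L / 4 := convexity_le_quarter hL hVconv (ex_intro _ (e0 i0) (he0 i0)) hcalR.
pose f := fdist L K calR T; pose E := expR (- R1 L K calR T / T).
pose ga := gammaC L K calR T; pose et := eps * Lt.
pose r i := enorm (z i); pose ph i := expR (- r i / T).
pose u i w := frob (e i) (row i (xiM w)).
pose acc i w := Vu i w <= phi01 (u i w + ga * r i) / phi01 (u i w).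
(* The decrease without reflection, credited to every outcome; [h] charges a reflection for
   returning it as well as for the increase of [f]. *)
pose drop i := if r i < Rt then 9 / 10 * (ga * T * (ph i * r i))
  else 36 / 100 * (K * T ^+ 2 * (E * r i)).
(* [1.76 = 1.6 * 1.1] combines the weight of [Q] with its bound by the mean of [b]; in [h] it
   doubles because a reflection adds [2 T |u|] to [b]. *)
pose A i := f (r i) - drop i + 176 / 100 * (et * T ^+ 2 * r i).
pose h i (x : R) := T * ph i * (9 / 10 * (ga * r i) + 1 + 1 / 4 * Num.max 0 (`|x| - 1))
  + 352 / 100 * (et * T ^+ 3) * `|x|.
pose G i w := if r i < Rt then (if acc i w then 0 else h i (u i w)) else 0.
have T0 := ltW hT; have K0 := ltW hK.
have R10 := R1_ge0 L K hcalR hT.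
have et0 : 0 <= et by rewrite mulr_ge0.
have r0 i : 0 <= r i by exact: enorm_ge0.
have e1 i : enorm (e i) = 1.
  rewrite /e; case: eqVneq => [_|zn0]; first exact: he0.
  have rn0 : enorm (z i) != 0 by apply: contra_neq zn0; exact: enorm_eq0.
  by rewrite enormZ ger0_norm ?invr_ge0 ?enorm_ge0// mulVf.
have LT := LT2_le hstep.
have eK := interaction_le_K hK hcalR hT KL hstep heLt.
have etaE i w : row i (etaM w) = eta_i Rt ga (row i (xiM w)) (z i) (e i) (Vu i w).
  by apply/rowP => k; rewrite !mxE.
have w0E i w : row i (xiM w) - row i (etaM w) =
    if r i < Rt then (if acc i w then - (ga *: z i) else (2 * u i w) *: e i) else 0.
  rewrite etaE /eta_i -/(r i) leNgt; case: (r i < Rt) => /=; last by rewrite subrr.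
  rewrite -/(u i w) -/(acc i w); case: (acc i w).
    by rewrite opprD addrA subrr sub0r.
  by rewrite subKr.
have pw w : N%:R^-1 * \sum_(i < N) rhoT (row i (qf x (xiM w) T)) (row i (qf x' (etaM w) T))
    <= N%:R^-1 * \sum_(i < N) (A i + G i w).
  (* Free motion: constant for equal velocities, shrinking after an accepted shift, and longer by at
     most [2 T |u|] after a reflection. *)
  pose b i := r i + (if r i < Rt then (if acc i w then 0 else 2 * T * `|u i w|) else 0).
  have hb i (t : R) : 0 <= t <= T ->
      enorm (row i (qf x (xiM w) 0) - row i (qf x' (etaM w) 0) +
        t *: (row i (pf x (xiM w) 0) - row i (pf x' (etaM w) 0))) <= b i.
    move=> /andP[t0 tT]; rewrite !hq0 !hp0 w0E -/(z i) /b.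
    have [rR|rR] := ltP (r i) Rt; last by rewrite scaler0 !addr0.
    have [ga0 gaT _ _] := gamma_props hL hcalR hT hstep (le_lt_trans (r0 i) rR).
    case: (acc i w).
      rewrite addr0 scalerN scalerA -[X in X - _]scale1r -scalerBl enormZ.
      have gat : t * ga <= 1 by rewrite (le_trans _ gaT)// mulrC ler_wpM2l.
      rewrite ger0_norm ?subr_ge0// ler_piMl ?enorm_ge0//.
      by rewrite gerBl mulr_ge0.
    rewrite (le_trans (enormD _ _))// lerD2l !enormZ e1 mulr1 ger0_norm// normrM.
    by rewrite [`|2|]ger0_norm// mulrA [t * 2]mulrC ler_wpM2r// ler_wpM2l.
  have [Q [Q0 Qb flow]] := flow_estimates hV_grad hW_diff hW_grad1 hL hK hLt hVlip hVconv
    hWsym hWlip (hqd x (xiM w)) (hpd x (xiM w)) (hqd x' (etaM w)) (hpd x' (etaM w))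
    hT heps N0 LT KL eK hb.
  have per i : rhoT (row i (qf x (xiM w) T)) (row i (qf x' (etaM w) T)) <=
      f (r i) - drop i + (if r i < Rt then (if acc i w then 0 else
        T * ph i * (9 / 10 * (ga * r i) + 1 + 1 / 4 * Num.max 0 (`|u i w| - 1))) else 0)
      + 16 / 10 * Q.
    have [fl1 fl2 fl3] := flow i; move: fl1 fl2 fl3.
    rewrite !hq0 !hp0 w0E -/(z i) -/(r i) /rhoT /rho -/f /drop /b.
    set s := enorm _; have s0 : 0 <= s by exact: enorm_ge0.
    have [rR|rR] := ltP (r i) Rt; last first.
      move=> _ fl2 _; have hR : calR <= 82 / 100 * r i.
        by rewrite (le_trans (calR_le hK hcalR KL))// ler_wpM2l.
      have := rho_far hK hcalR hT KL hstep (r0 i) s0 Q0 (fl2 erefl hR).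
      by rewrite -/f -/E addr0.
    have [ga0 gaT _ LTg] := gamma_props hL hcalR hT hstep (le_lt_trans (r0 i) rR).
    case: (acc i w) => fl1 _ fl3.
      have := rho_coalesce hL hcalR hT hstep (r0 i) rR s0 Q0 (fl3 _ erefl ga0 gaT LTg).
      by rewrite -/f -/(ph i) addr0.
    have := rho_reflect hcalR hT (r0 i) rR s0 Q0 fl1.
    rewrite -/f -/(ph i) => /le_trans; apply.
    by rewrite le_eqVlt; apply/orP; left; apply/eqP; ring.
  have NQ : N%:R^-1 * \sum_(i < N) (16 / 10 * Q) = 16 / 10 * Q.
    by rewrite sumr_const card_ord -[X in _ * X]mulr_natl mulrA mulVf ?mul1r// pnatr_eq0 -lt0n.
  have iN0 : 0 <= N%:R^-1 :> R by rewrite invr_ge0.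
  pose J i := f (r i) - drop i + (if r i < Rt then (if acc i w then 0 else
    T * ph i * (9 / 10 * (ga * r i) + 1 + 1 / 4 * Num.max 0 (`|u i w| - 1))) else 0).
  apply: (@le_trans _ _ (N%:R^-1 * \sum_(i < N) J i + 16 / 10 * Q)).
    rewrite -NQ -mulrDr ler_wpM2l// -big_split/=.
    by apply: ler_sum => i _; exact: per.
  (* Replacing [Q] by the mean of [b] distributes the interaction over the particles, so that each
     one can be treated separately. *)
  apply: (@le_trans _ _ (N%:R^-1 * \sum_(i < N) J i +
      N%:R^-1 * (16 / 10 * (11 / 10 * (et * T ^+ 2)) * \sum_(i < N) b i))).
    rewrite lerD2l (le_trans (ler_wpM2l _ Qb))// le_eqVlt; apply/orP; left; apply/eqP.
    by rewrite /et; set B := \sum_(i < N) _; set iN := N%:R^-1; ring.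
  rewrite -mulrDr ler_wpM2l// mulr_sumr -big_split/=.
  apply: ler_sum => i _.
  rewrite /J /A /G /h /b /= le_eqVlt; apply/orP; left; apply/eqP.
  by case: (r i < Rt); [case: (acc i w)|]; field.
have uE i w : u i w = \sum_(k < d) e i 0 k * xi i k w.
  by rewrite /u frob_row_vector; apply: eq_bigr => k _; rewrite !mxE.
pose X (j : ('I_N * 'I_d) + 'I_N) :=
  match j with inl ik => (xi ik.1 ik.2 : Omega -> R) | inr i => (Vu i : Omega -> R) end.
have mX j : measurable_fun setT (X j) by case: j => [ik|i]; exact: measurable_funP.
have mu_ i : measurable_fun setT (u i).
  rewrite (_ : u i = fun w => \sum_(k < d) e i 0 k * xi i k w); last exact/funext/uE.
  by apply: measurable_sum => k; exact: measurable_funM.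
have mh i : measurable_fun setT (h i).
  apply: measurable_funD; apply: measurable_funM => //.
  apply: measurable_funD => //; apply: measurable_funM => //.
  by apply: measurable_maxr => //; apply: measurable_funB.
have h0 i y : 0 <= ga -> 0 <= h i y.
  move=> ga0; have m0 : 0 <= Num.max 0 (`|y| - 1) by rewrite le_max lexx.
  have eT : 0 <= 352 / 100 * (et * T ^+ 3).
    by apply: mulr_ge0; [exact: divr_ge0 (ler0n _ _) (ler0n _ _)|exact: mulr_ge0 et0 (exprn_ge0 _ T0)].
  apply: addr_ge0; last exact: mulr_ge0.
  apply: mulr_ge0; first by apply: mulr_ge0 => //; exact: expR_ge0.
  by apply: addr_ge0; [apply: addr_ge0 => //|]; apply: mulr_ge0 => //; exact: mulr_ge0.
have mG i : measurable_fun setT (G i).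
  rewrite /G; case: (r i < Rt) => //; apply: measurable_fun_ifT => //.
    rewrite /acc; under eq_fun do rewrite phi01_ratio.
    apply: measurable_fun_ler; first exact: measurable_funP.
    apply: measurableT_comp => //; apply: measurableT_comp => //.
    by apply: measurable_funD => //; exact: measurable_funM.
  exact: measurableT_comp.
have G0 i w : 0 <= G i w.
  rewrite /G; case: ifP => // rR; case: ifP => // _; apply: h0.
  by have [] := gamma_props hL hcalR hT hstep (le_lt_trans (r0 i) rR).
have A0 i : 0 <= A i.
  rewrite /A addr_ge0 ?mulr_ge0 ?exprn_ge0// subr_ge0 /drop.
  by case: ifP => rR; [exact: near_drop_le|exact: far_drop_le].
(* Contraction for one particle in expectation; the noise enters through [u i] and [Vu i] only. *)
have AG i : ((A i)%:E + \int[P]_w (G i w)%:E <= ((1 - c) * f (r i))%:E)%E.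
  rewrite /G /A /drop; case: ifP => rR; last first.
    rewrite integral0 adde0 lee_fin.
    exact: (budget_far hK hcalR hT KL hstep heLt (r0 i)).
  have [ga0 gaT gaR _] := gamma_props hL hcalR hT hstep (le_lt_trans (r0 i) rR).
  have a4 : ga * r i <= 1 / 4 by rewrite (le_trans _ gaR)// ler_wpM2l// ltW.
  have inj : injective (fun k : 'I_d => inl (i, k) : ('I_N * 'I_d) + 'I_N).
    by move=> k l [].
  have c1 : \sum_(k < d) e i 0 k ^+ 2 = 1.
    have := enorm_sqr (e i); rewrite e1 expr1n frob_row_vector => ->.
    by apply: eq_bigr => k _; rewrite expr2.
  have W0 : 0 <= 36 / 100 * (T * ph i) + 352 / 100 * (et * T ^+ 3).
    apply: addr_ge0; (apply: mulr_ge0; first exact: divr_ge0 (ler0n _ _) (ler0n _ _)).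
      exact: mulr_ge0 T0 (expR_ge0 _).
    exact: mulr_ge0 et0 (exprn_ge0 _ T0).
  have nj (k : 'I_d) : (inl (i, k) : ('I_N * 'I_d) + 'I_N) != inr i by [].
  have := reflection_integral_le hindep mX (j0 := inr i) inj nj (fun k => hxi_law i k)
    (hV_law i) c1 (mulr_ge0 ga0 (r0 i)) a4 (mh i) (fun y => h0 i y ga0)
    (fun y y8 => reflect_weight hL hcalR hT hstep et0 (r0 i) rR y8) W0.
  rewrite /= => H.
  apply: (@le_trans _ _ ((A i)%:E + (61 / 25 * (36 / 100 * (T * ph i) +
     352 / 100 * (et * T ^+ 3)) * (ga * r i))%:E)%E).
    rewrite /A /drop rR leeD2l//; apply: le_trans H.
    apply: ge0_integral_mono => w; last by rewrite /acc uE.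
    by rewrite lee_fin; case: (acc i w) => //; exact: h0.
  rewrite /A /drop rR -EFinD lee_fin.
  exact: (budget_near hL hK hcalR hT KL hstep et0 heLt (r0 i) rR).
(* The pathwise bound replaces the flow by an integrand measurable in the noise; linearity of the
   integral is used only from here on. *)
apply: (@le_trans _ _ (\int[P]_w (N%:R^-1 * \sum_(i < N) (A i + G i w))%:E)%E).
  apply: ge0_integral_mono => w; last by rewrite lee_fin.
  rewrite lee_fin mulr_ge0 ?invr_ge0// sumr_ge0// => i _.
  by apply: fdist_ge0 => //; exact: enorm_ge0.
have iN0 : 0 <= N%:R^-1 :> R by rewrite invr_ge0.
have mAG i : measurable_fun setT (fun w => A i + G i w) by exact: measurable_funD.
have AG0 i w : 0 <= A i + G i w by exact: addr_ge0.
under eq_integral do rewrite EFinM.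
rewrite ge0_integral_scale//; [|exact: measurable_sum|by move=> w; exact: sumr_ge0].
have -> : (\int[P]_w (\sum_(i < N) (A i + G i w))%:E = \sum_(i < N) \int[P]_w (A i + G i w)%:E)%E.
  under eq_integral do rewrite -sumEFin.
  apply: ge0_integral_sum => // i; first exact/measurable_EFinP.
  by move=> w _; rewrite lee_fin.
rewrite mulrCA [leRHS]EFinM lee_wpmul2l ?lee_fin// mulr_sumr -sumEFin.
apply: lee_sum => i _; apply: le_trans (AG i).
under eq_integral do rewrite EFinD.
rewrite ge0_integralD => [|//|w _|//|w _|]; first by rewrite probability_integral_cst.
- by rewrite lee_fin.
- by rewrite lee_fin.
- exact/measurable_EFinP.
Qed.
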